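(* Let $a_1,\dots,a_m\in\mathbb R^n$ be independent $N(0,I_n)$ measurement vectors and let $\tau_x,\tau_z,\tau_h$ be the prescribed truncation parameters (all objects are defined in the context). Let $\varepsilon_0>0$ be a numerical constant satisfying $$\varepsilon_0\le\frac12\min\left\{\sqrt{\frac{\rho_3}{3(\tau_z^4+5\tau_z^3+8\tau_z^2+2\tau_h^2)}},\ \frac{\rho_3}{15\,\tau_z\tau_{h,z}},\ \frac1{11}\right\},$$ where $\rho_3>0$ is a sufficiently small constant. Then, provided $m\ge Cn$, with probability exceeding $1-e^{-cm}$ the inequality $$\frac1m\bigl\|\mathcal P_{T_z}\mathcal A_z^\top\mathcal A_z(\mathcal I-\mathcal P_{T_z})(zz^\top-xx^\top)\bigr\|_F\le\sqrt{\rho_4\vartheta_{\mathrm{up}}}\;\|zz^\top-xx^\top\|_F$$ holds uniformly for all $zz^\top$ ($z\in\mathbb R^n$) obeying $\|zz^\top-xx^\top\|_F\le\varepsilon_0\|X\|_F$, where $$\rho_4=\rho_3+6\tau_h\tau_{h,z}^2e^{-0.64\tau_h^2}+\eta,$$ $\eta>0$ is an arbitrarily small fixed constant, and $C,c>0$ are constants not depending on $n$, $m$ or $x$ (they may depend on $\eta$ and the truncation parameters).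
   Context: Setting: $x\in\mathbb R^n$ is the (nonzero) ground truth, $X=xx^\top$; $y\in\mathbb R^m$ with $y_k=|a_k^\top x|^2$. $\|\cdot\|_F$ is the Frobenius norm, $\|\cdot\|$ the Euclidean norm of a vector, $\|\cdot\|_1$ the $\ell_1$ norm. For symmetric $W\in\mathbb R^{n\times n}$, $\mathcal A(W)=(a_k^\top Wa_k)_{k=1}^m$. Truncation events (for $z\ne0$, $k=1,\dots,m$): $\mathcal E_1^k(x)=\{\sqrt{y_k}\le\tau_x\sqrt{\|y\|_1/m}\}$, $\mathcal E_1^k(z)=\{|a_k^\top z|\le\tau_z\|z\|\}$, $\mathcal E_2^k(z)=\{|y_k-|a_k^\top z|^2|\le\frac{\tau_h}{m}\|y-\mathcal A(zz^\top)\|_1\frac{|a_k^\top z|+\sqrt{y_k}}{\|z\|}\}$. Truncated operator: $\mathcal A_z(W)=\bigl(a_k^\top Wa_k\,\mathbf 1_{\mathcal E_1^k(x)\cap\mathcal E_1^k(z)\cap\mathcal E_2^k(z)}\bigr)_{k=1}^m$, with adjoint $\mathcal A_z^\top(b)=\sum_{k=1}^m b_k a_ka_k^\top\mathbf 1_{\mathcal E_1^k(x)\cap\mathcal E_1^k(z)\cap\mathcal E_2^k(z)}$. $T_z=\{zw^\top+wz^\top: w\in\mathbb R^n\}$; with $u=z/\|z\|$, $\mathcal P_{T_z}(W)=uu^\top W+Wuu^\top-uu^\top Wuu^\top$ is the orthogonal projection onto $T_z$; $\mathcal I$ is the identity operator. Constants: $\tau_{h,z}=\tau_z+\bigl(0.3\tau_h(\tau_z+1.2\tau_x)+\tau_z^2\bigr)^{1/2}$.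 With $\xi\sim N(0,1)$: $\vartheta_1=\mathbb E[|\xi|^4\mathbf 1_{|\xi|\le\tau_z}]-\mathbb E[|\xi|^2\mathbf 1_{|\xi|\le\tau_z}]$, $\vartheta_2=\mathbb E[|\xi|^2\mathbf 1_{|\xi|\le\tau_z}]$; $\rho_1=10\tau_z^3e^{-0.49\tau_z^2}+\eta$; $\vartheta_{\mathrm{up}}=\max\{\vartheta_1+\vartheta_2+\rho_1,\,2(\vartheta_2+\rho_1)\}$. *)

(* Defs.v *)
From HB Require Import structures.
From mathcomp Require Export all_boot all_order all_algebra.
From mathcomp Require Export all_classical all_reals all_analysis.
Export Order.TTheory GRing.Theory Num.Theory numFieldNormedType.Exports.

Set Implicit Arguments.
Unset Strict Implicit.
Unset Printing Implicit Defensive.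

Local Open Scope classical_set_scope.
Local Open Scope ring_scope.

(* The Euclidean norm of v : 'cV_n is frob v; the library's `|v| on matrices is
   the sup norm. *)
Definition frob {R : realType} {p q : nat} (A : 'M[R]_(p, q)) : R :=
  Num.sqrt (\sum_i \sum_j A i j ^+ 2).

Definition norm1 {R : realType} {m : nat} (v : 'cV[R]_m) : R :=
  \sum_k `|v k 0|.

Definition dotv {R : realType} {n : nat} (u v : 'cV[R]_n) : R :=
  (u^T *m v) 0 0.

Definition measA {R : realType} {n m : nat} (a : 'I_m -> 'cV[R]_n)
    (W : 'M[R]_n) : 'cV[R]_m :=
  \col_k ((a k)^T *m W *m a k) 0 0.

Definition measy {R : realType} {n m : nat} (a : 'I_m -> 'cV[R]_n)
    (x : 'cV[R]_n) : 'cV[R]_m :=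
  \col_k (`|dotv (a k) x| ^+ 2).

Definition trunc1x {R : realType} {n m : nat} (tau_x : R)
    (a : 'I_m -> 'cV[R]_n) (x : 'cV[R]_n) (k : 'I_m) : bool :=
  Num.sqrt (measy a x k 0) <= tau_x * Num.sqrt (norm1 (measy a x) / m%:R).

Definition trunc1z {R : realType} {n m : nat} (tau_z : R)
    (a : 'I_m -> 'cV[R]_n) (z : 'cV[R]_n) (k : 'I_m) : bool :=
  `|dotv (a k) z| <= tau_z * frob z.

Definition trunc2z {R : realType} {n m : nat} (tau_h : R)
    (a : 'I_m -> 'cV[R]_n) (x z : 'cV[R]_n) (k : 'I_m) : bool :=
  `|measy a x k 0 - `|dotv (a k) z| ^+ 2|
    <= tau_h / m%:R * norm1 (measy a x - measA a (z *m z^T))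
       * ((`|dotv (a k) z| + Num.sqrt (measy a x k 0)) / frob z).

Definition trunc {R : realType} {n m : nat} (tau_x tau_z tau_h : R)
    (a : 'I_m -> 'cV[R]_n) (x z : 'cV[R]_n) (k : 'I_m) : bool :=
  [&& trunc1x tau_x a x k, trunc1z tau_z a z k & trunc2z tau_h a x z k].

Definition measAz {R : realType} {n m : nat} (tau_x tau_z tau_h : R)
    (a : 'I_m -> 'cV[R]_n) (x z : 'cV[R]_n) (W : 'M[R]_n) : 'cV[R]_m :=
  \col_k (measA a W k 0 * (trunc tau_x tau_z tau_h a x z k)%:R).

Definition adjAz {R : realType} {n m : nat} (tau_x tau_z tau_h : R)
    (a : 'I_m -> 'cV[R]_n) (x z : 'cV[R]_n) (b : 'cV[R]_m) : 'M[R]_n :=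
  \sum_k (b k 0 * (trunc tau_x tau_z tau_h a x z k)%:R) *: (a k *m (a k)^T).

Definition projT {R : realType} {n : nat} (z : 'cV[R]_n) (W : 'M[R]_n)
    : 'M[R]_n :=
  let u := (frob z)^-1 *: z in
  let U := u *m u^T in
  U *m W + W *m U - U *m W *m U.

Definition tau_hz {R : realType} (tau_x tau_z tau_h : R) : R :=
  tau_z + Num.sqrt (3 / 10 * tau_h * (tau_z + 12 / 10 * tau_x) + tau_z ^+ 2).

Definition vartheta2 {R : realType} (tau_z : R) : R :=
  fine (expectation (normal_prob 0 1) (fun xi : R =>
    `|xi| ^+ 2 * \1_[set t : R | `|t| <= tau_z] xi)).

Definition vartheta1 {R : realType} (tau_z : R) : R :=
  fine (expectation (normal_prob 0 1) (fun xi : R =>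
    `|xi| ^+ 4 * \1_[set t : R | `|t| <= tau_z] xi)) - vartheta2 tau_z.

Definition rho1 {R : realType} (tau_z eta : R) : R :=
  10 * tau_z ^+ 3 * expR (- (49 / 100) * tau_z ^+ 2) + eta.

Definition vartheta_up {R : realType} (tau_z eta : R) : R :=
  Num.max (vartheta1 tau_z + vartheta2 tau_z + rho1 tau_z eta)
          (2 * (vartheta2 tau_z + rho1 tau_z eta)).

Definition rho4 {R : realType} (tau_x tau_z tau_h eta rho3 : R) : R :=
  rho3 + 6 * tau_h * tau_hz tau_x tau_z tau_h ^+ 2
           * expR (- (64 / 100) * tau_h ^+ 2) + eta.

Definition eps0_bound {R : realType} (tau_x tau_z tau_h rho3 : R) : R :=
  1 / 2 * Num.min
    (Num.sqrt (rho3 / (3 * (tau_z ^+ 4 + 5 * tau_z ^+ 3 + 8 * tau_z ^+ 2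
                            + 2 * tau_h ^+ 2))))
    (Num.min (rho3 / (15 * tau_z * tau_hz tau_x tau_z tau_h)) (1 / 11)).

(* Random vectors are n.-tuple R-valued: 'cV[R]_n carries no measurable
   structure in the library, while n.-tuple R carries the Borel sigma-algebra
   of R^n. *)

(* X ~ N(0, I_n): the coordinates are i.i.d. N(0, 1); rectangles generate the
   Borel sets of R^n, so this determines the law. *)
Definition std_gaussian_vector {d : measure_display} {T : measurableType d}
    {R : realType} (P : probability T R) {n : nat}
    (X : {RV P >-> n.-tuple R}) : Prop :=
  forall B : 'I_n -> set R, (forall i, measurable (B i)) ->
    P (X @^-1` [set t | forall i, B i (tnth t i)])
    = (\prod_(i < n) normal_prob 0 1 (B i))%E.

Definition mutually_independent {d d' : measure_display}
    {T : measurableType d} {T' : measurableType d'}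
    {R : realType} (P : probability T R) {I : finType}
    (X : I -> {RV P >-> T'}) : Prop :=
  forall (J : {set I}) (B : I -> set T'), (forall i, measurable (B i)) ->
    P (\bigcap_(i in [set` J]) X i @^-1` B i)
    = (\prod_(i in J) P (X i @^-1` B i))%E.

Definition sample {d : measure_display} {T : measurableType d} {R : realType}
    (P : probability T R) {n m : nat} (a : 'I_m -> {RV P >-> n.-tuple R})
    (w : T) : 'I_m -> 'cV[R]_n :=
  fun k => \col_i tnth (a k w) i.

(* The event below is an uncountable intersection over z and need not be
   measurable, so "A has probability exceeding p" is read as: A contains a
   measurable event of probability exceeding p. *)
Definition prob_exceeds {d : measure_display} {T : measurableType d}
    {R : realType} (P : probability T R) (p : R) (A : set T) : Prop :=
  exists E : set T, [/\ measurable E, E `<=` A & (p%:E < P E)%E].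

(* Main.v *)
From mathcomp Require Import measurable_realfun measurable_fun_approximation.
From mathcomp Require Import ring lra.
Require Import Defs.

Set Implicit Arguments.
Unset Strict Implicit.
Unset Printing Implicit Defensive.

Local Open Scope classical_set_scope.
Local Open Scope ring_scope.

(* With [u = z / |z|] and [h = x - (u . x) u], the residual
   [(I - P_T)(z z^T - x x^T)] is [- h h^T], and [|x| |h| <= |z z^T - x x^T|]
   (evaluate the matrix at [x] and [h]).  Writing [S] for the adjoint applied to
   the truncated measurements of [- h h^T], [P_T S] is controlled by [S u], and
   Cauchy-Schwarz bounds [|S u|^2] by [tau_z^2] times the sum of the truncated
   [(a_k . h)^4] and the operator norm of [\sum_k a_k a_k^T].  On the truncation
   event [|a_k . h| <= K |x|], so everything follows from one uniform bound: the
   averages of [psi M (a_k . v)], with [psi M t = t^4 / (1 + t^2 / M^2)], are at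
   most a constant [D], independent of [M], for all unit [v].  Indeed
   [(a_k . h)^4 = (1 + (a_k . h)^2 / (M |h|)^2) |h|^4 psi M (a_k . h / |h|)], so
   the sum of fourth powers is at most
   [m D |h|^2 (|h|^2 + K^2 |x|^2 / M^2)], where the first term is absorbed by
   [rho3] (as [eps0] is at most a multiple of [rho3]) and the second, for [M]
   large, by [eta].

   The uniform bound is proved by a Chernoff estimate at each point of a lattice
   net of the ball; as [psi M] is convex, the net controls the whole ball. *)

(** * Integrals of products of independent variables *)

Import HBNNSimple.

(** The hypothesis on indicators says that [nu] is the image under [X] of the measure with density
    [G]; linearity extends it to simple functions and monotone convergence to nonnegative [f]. It
    serves both for the normal density ([X] the identity) and for splitting off one independent
    variable. *)
Lemma integral_density (d d' : measure_display) (T : measurableType d)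
    (S : measurableType d') (R : realType) (mu : {measure set T -> \bar R})
    (nu : {measure set S -> \bar R}) (G : T -> R) (X : T -> S)
    (f : S -> \bar R) :
  measurable_fun [set: T] G -> (forall x, 0 <= G x) -> measurable_fun [set: T] X ->
  (forall B, measurable B ->
    \int[mu]_x ((G x)%:E * (\1_B (X x))%:E) = nu B)%E ->
  measurable_fun [set: S] f -> (forall y, 0 <= f y)%E ->
  (\int[mu]_x ((G x)%:E * f (X x)) = \int[nu]_y f y)%E.
Proof.
move=> mG G0 mX GX mf f0.
pose f_ := nnsfun_approx measurableT mf.
have mfX n : measurable_fun setT (fun x => (f_ n (X x))%:E).
  by apply/measurable_EFinP; exact: measurableT_comp.
have nsf n : (\int[mu]_x ((G x)%:E * (f_ n (X x))%:E) = \int[nu]_y (f_ n y)%:E)%E.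
  under [RHS]eq_integral do rewrite fimfunE -fsumEFin//.
  rewrite [RHS]ge0_integral_fsum//; last 2 first.
  - by move=> r; exact/measurable_EFinP/measurableT_comp.
  - by move=> r x _; rewrite EFinM nnfun_muleindic_ge0.
  under [LHS]eq_integral.
    move=> x _; rewrite fimfunE -fsumEFin// ge0_mule_fsumr; last first.
      by move=> r; rewrite EFinM nnfun_muleindic_ge0.
    over.
  have mGr r : measurable_fun setT
      (fun x => ((G x)%:E * (r * \1_(f_ n @^-1` [set r]) (X x))%:E)%E).
    apply: emeasurable_funM; first exact/measurable_EFinP.
    apply/measurable_EFinP/measurable_funM; first exact: measurable_cst.
    by apply: measurableT_comp => //; exact: measurable_indic.
  rewrite [LHS]ge0_integral_fsum//; last first.
    move=> r x _; apply: mule_ge0; first by rewrite lee_fin.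
    by rewrite EFinM nnfun_muleindic_ge0.
  apply: eq_fsbigr => r; rewrite inE => -[y _ <-].
  under eq_integral do rewrite EFinM muleCA.
  rewrite ge0_integralZl//; last 3 first.
  - apply: emeasurable_funM; first exact/measurable_EFinP; apply/measurable_EFinP.
    by apply: measurableT_comp => //; exact: measurable_indic.
  - by move=> x _; rewrite mule_ge0// lee_fin.
  - by rewrite lee_fin.
  rewrite GX//.
  under [RHS]eq_integral do rewrite EFinM.
  rewrite [RHS]ge0_integralZl//.
  - by rewrite integral_indic// setIT.
  - exact/measurable_EFinP/measurable_indic.
  - by rewrite lee_fin.
have cf y : EFin \o f_^~ y @ \oo --> f y by exact: cvg_nnsfun_approx.
transitivity (limn (fun n => \int[mu]_x ((G x)%:E * (f_ n (X x))%:E)))%E.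
  rewrite -monotone_convergence//=.
  - apply: eq_integral => x _; apply/esym/cvg_lim => //.
    by apply: cvgeZl => //; exact: (cf (X x)).
  - by move=> n; apply: emeasurable_funM; first exact/measurable_EFinP; exact: mfX.
  - by move=> n x _; rewrite mule_ge0// lee_fin.
  - move=> x _ a b ab; rewrite lee_wpmul2l ?lee_fin//.
    exact/lefP/nd_nnsfun_approx.
under eq_fun do rewrite nsf.
rewrite -monotone_convergence//=.
- by apply: eq_integral => y _; apply/cvg_lim => //; exact: cf.
- by move=> n; apply/measurable_EFinP.
- by move=> n x _; rewrite lee_fin.
- by move=> x _ a b ab; rewrite lee_fin; exact/lefP/nd_nnsfun_approx.
Qed.

Lemma prod_indic_forall (R : realType) (I : finType) (S : Type)
    (B : I -> set S) (X : I -> S) :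
  \prod_i \1_(B i) (X i) = (\1_[set t : I -> S | forall i, B i (t i)] X : R).
Proof.
rewrite indicE; case: (boolP (X \in _)) => [/set_mem/= XB|].
  by rewrite big1// => i _; rewrite indicE mem_set.
rewrite notin_setE => /existsNP[i Bi].
by rewrite (bigD1 i)//= indicE memNset// mul0r.
Qed.

(** Induction on a list containing every index whose function is not known to be an indicator. With
    indicators only, the claim is the product rule for rectangles; one general factor is restored by
    [integral_density], the product of the other factors being the density. *)
Lemma integral_prod_indep (d d' : measure_display) (T : measurableType d)
    (S : measurableType d') (R : realType) (P : probability T R) (I : finType)
    (Q : I -> probability S R) (X : I -> T -> S) (g : I -> S -> R) :
  (forall i, measurable_fun [set: T] (X i)) ->
  (forall B : I -> set S, (forall i, measurable (B i)) ->
    P [set w | forall i, B i (X i w)] = (\prod_i Q i (B i))%E) ->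
  (forall i, measurable_fun [set: S] (g i)) -> (forall i y, 0 <= g i y) ->
  (forall i, \int[Q i]_y (g i y)%:E < +oo)%E ->
  (\int[P]_w (\prod_i g i (X i w))%:E = \prod_i \int[Q i]_y (g i y)%:E)%E.
Proof.
move=> mX PX.
suff H (s : seq I) : forall g : I -> S -> R,
    (forall i, i \notin s -> exists2 B, measurable B & g i = \1_B) ->
    (forall i, measurable_fun [set: S] (g i)) -> (forall i y, 0 <= g i y) ->
    (forall i, \int[Q i]_y (g i y)%:E < +oo)%E ->
    (\int[P]_w (\prod_i g i (X i w))%:E = \prod_i \int[Q i]_y (g i y)%:E)%E.
  by apply: (H (index_enum I)) => i; rewrite mem_index_enum.
elim: s => [|j s IH] {}g gB mg g0 gfin.
  have /choice[B HB] : forall i, exists B, measurable B /\ g i = \1_B.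
    by move=> i; have [//|B mB gE] := gB i; exists B.
  under eq_integral.
    move=> w _.
    rewrite (eq_bigr (fun i => \1_(B i) (X i w))); last first.
      by move=> i _; rewrite (HB i).2.
    rewrite prod_indic_forall.
    over.
  have mE : measurable [set w | forall i, B i (X i w)].
    rewrite (_ : [set w | _] = \bigcap_(i in [set: I]) X i @^-1` B i).
      apply: fin_bigcap_measurable => // i _.
      by rewrite -[X in measurable X]setTI; apply: mX => //; exact: (HB i).1.
    by apply/seteqP; split=> w /= H i; [move=> _|]; exact: H.
  rewrite (eq_integral
    (fun w => (\1_[set w | forall i, B i (X i w)] w)%:E)); last first.
    by move=> w _; rewrite !indicE.
  rewrite integral_indic// setIT.
  transitivity (\prod_i Q i (B i))%E.
    by apply: PX => i; exact: (HB i).1.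
  apply: eq_bigr => i _; rewrite (HB i).2 integral_indic ?setIT//.
  exact: (HB i).1.
(* The product [c] is finite and nonnegative, so the multiple [c * Q j] is a measure; it is the [nu]
   of [integral_density]. *)
pose c := (\prod_(i | i != j) \int[Q i]_y (g i y)%:E)%E.
have ig0 i : (0 <= \int[Q i]_y (g i y)%:E)%E.
  by apply: integral_ge0 => y _; rewrite lee_fin.
have [r r0 cE] : exists2 r : {nonneg R}, True & c = (r%:num)%:E.
  have : (c \is a fin_num) && (0 <= c)%E.
    rewrite /c; apply: (big_ind (fun z => (z \is a fin_num) && (0 <= z)%E)) =>
      [|x y /andP[xf x0] /andP[yf y0]|i _].
    - by rewrite lee_fin ler01.
    - by rewrite fin_numM//= mule_ge0.
    - by rewrite ge0_fin_numE ?gfin ?ig0.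
  case/andP => cf c0.
  have r0 : 0 <= fine c by exact: fine_ge0.
  by exists (NngNum r0) => //=; rewrite fineK.
rewrite [RHS](bigD1 j)//= -/c muleC cE.
under eq_integral do rewrite (bigD1 j)//= mulrC EFinM.
rewrite -ge0_integral_mscale//; last 2 first.
- exact/measurable_EFinP.
- by move=> y _; rewrite lee_fin.
apply: integral_density => //.
- under eq_fun do rewrite -big_filter.
  by apply: measurable_prod => i _; exact: measurableT_comp.
- by move=> w; rewrite prodr_ge0.
- move=> B mB.
  (* Putting an indicator in place of [g j] takes [j] off the list, so [IH] applies. *)
  pose h i := if i == j then \1_B : S -> R else g i.
  have hB w : \prod_i h i (X i w) = (\prod_(i | i != j) g i (X i w)) * \1_B (X j w).
    rewrite (bigD1 j)//= mulrC /h eqxx; congr (_ * _).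
    by apply: eq_bigr => i /negbTE ->.
  transitivity (\int[P]_w (\prod_i h i (X i w))%:E)%E.
    by apply: eq_integral => w _; rewrite hB EFinM.
  rewrite IH//.
  + rewrite (bigD1 j)//= /h eqxx integral_indic// setIT.
    rewrite (eq_bigr (fun i => \int[Q i]_y (g i y)%:E)%E).
      by rewrite -/c cE /mscale/= muleC.
    by move=> i /negbTE ->.
  + move=> i; rewrite /h; case: eqVneq => [_|ij iNs]; first by exists B.
    by apply: gB; rewrite inE negb_or ij.
  + move=> i; rewrite /h; case: ifP => _ //; exact: measurable_indic.
  + by move=> i y; rewrite /h; case: ifP => _ //.
  + move=> i; rewrite /h; case: ifP => _ //; rewrite integral_indic// setIT.
    by rewrite (le_lt_trans (probability_le1 _ _))// ltry.
- exact/measurable_EFinP.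
- by move=> y; rewrite lee_fin.
Qed.

(** * Gaussian vectors *)

Lemma integral_normal_prob (R : realType) (m s : R) (f : R -> \bar R) :
  measurable_fun [set: R] f -> (forall x, 0 <= f x)%E ->
  (\int[normal_prob m s]_x f x =
   \int[lebesgue_measure]_x ((normal_pdf m s x)%:E * f x))%E.
Proof.
move=> mf f0; apply/esym.
apply: (@integral_density _ _ _ _ _ lebesgue_measure (normal_prob m s) _ id) => //.
- exact: measurable_normal_pdf.
- by move=> x; exact: normal_pdf_ge0.
- move=> B mB; rewrite /normal_prob [RHS]integral_mkcond.
  by apply: eq_integral => x _; rewrite epatch_indic.
Qed.

(** Completing the square: [expR (s * x)] times the standard density is [expR (s ^+ 2 / 2)] times
    the density with mean [s]. *)
Lemma normal_mgf (R : realType) (s : R) :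
  (\int[normal_prob 0 1]_x (expR (s * x))%:E = (expR (s ^+ 2 / 2))%:E)%E.
Proof.
have mexp : measurable_fun [set: R] (fun x => (expR (s * x))%:E).
  by apply/measurable_EFinP; exact: measurableT_comp.
rewrite integral_normal_prob//.
transitivity
  (\int[lebesgue_measure]_x ((expR (s ^+ 2 / 2))%:E * (normal_pdf s 1 x)%:E))%E; last first.
  rewrite ge0_integralZl// ?integral_normal_pdf ?mule1//.
  - by apply/measurable_EFinP; exact: measurable_normal_pdf.
  - by move=> x _; rewrite lee_fin normal_pdf_ge0.
apply: eq_integral => x _; rewrite -!EFinM !normal_pdfE ?oner_eq0// /normal_fun.
congr EFin.
rewrite -mulrA [RHS]mulrCA -!expRD; congr (_ * expR _).
by rewrite expr1n; field.
Qed.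

(** As [1 / 2 - 3 / 8 = 1 / (2 * 2 ^ 2)], the integrand times the standard density is twice the
    centred density of standard deviation [2]. *)
Lemma integral_expR_sqr_normal (R : realType) :
  (\int[normal_prob 0 1]_x (expR (3 / 8 * x ^+ 2))%:E = 2%:E :> \bar R)%E.
Proof.
have mexp : measurable_fun [set: R] (fun x => (expR (3 / 8 * x ^+ 2))%:E).
  apply/measurable_EFinP; apply: measurableT_comp => //.
  by apply: measurable_funM => //; exact: measurable_funX.
rewrite integral_normal_prob//.
transitivity
  (\int[lebesgue_measure]_x ((2 : R)%:E * (normal_pdf 0 2 x)%:E))%E; last first.
  rewrite ge0_integralZl// ?integral_normal_pdf ?mule1//.
  - by apply/measurable_EFinP; exact: measurable_normal_pdf.
  - by move=> x _; rewrite lee_fin normal_pdf_ge0.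
apply: eq_integral => x _; rewrite -!EFinM !normal_pdfE ?oner_eq0 ?pnatr_eq0// /normal_fun.
congr EFin; rewrite -[LHS]mulrA -expRD.
have -> : normal_peak 1 = 2 * normal_peak 2 :> R.
  rewrite /normal_peak expr1n mul1r -mulrnAr sqrtrM ?sqr_ge0// sqrtr_sqr.
  by rewrite ger0_norm// invfM mulrA mulfV ?mul1r ?pnatr_eq0.
rewrite -[LHS]mulrA; congr (_ * (_ * expR _)).
by field.
Qed.

Definition tdot (R : realType) (n : nat) (v : 'cV[R]_n) (t : n.-tuple R) : R :=
  \sum_i tnth t i * v i 0.

Lemma measurable_tdot (R : realType) (n : nat) (v : 'cV[R]_n) :
  measurable_fun [set: n.-tuple R] (tdot v).
Proof.
apply: measurable_sum => i; apply: measurable_funM => //.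
exact: measurable_tnth.
Qed.

Section gaussian_vector.
Context (d : measure_display) (T : measurableType d) (R : realType)
  (P : probability T R) (n : nat) (X : {RV P >-> n.-tuple R}).
Hypothesis gX : std_gaussian_vector X.

Lemma gaussian_vector_mgf (v : 'cV[R]_n) (s : R) :
  (\int[P]_w (expR (s * tdot v (X w)))%:E =
   (expR (s ^+ 2 * (\sum_i v i 0 ^+ 2) / 2))%:E)%E.
Proof.
pose g (i : 'I_n) (y : R) := expR (s * v i 0 * y).
rewrite (eq_integral (fun w => (\prod_i g i (tnth (X w) i))%:E)); last first.
  move=> w _; rewrite /g -expR_sum /tdot mulr_sumr; congr (expR _)%:E.
  by apply: eq_bigr => i _; ring.
rewrite (integral_prod_indep (Q := fun=> normal_prob 0 1)).
- rewrite (eq_bigr (fun i => (expR ((s * v i 0) ^+ 2 / 2))%:E)); last first.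
    by move=> i _; rewrite /g normal_mgf.
  rewrite prodEFin -expR_sum; congr (expR _)%:E.
  by rewrite mulr_sumr mulr_suml; apply: eq_bigr => i _; rewrite exprMn.
- move=> i; exact: (measurableT_comp (measurable_tnth i) (measurable_funPT X)).
- by move=> B mB; exact: gX.
- by move=> i; apply: measurableT_comp => //; exact: measurable_funM.
- by move=> i y; exact: expR_ge0.
- by move=> i; rewrite /g normal_mgf ltry.
Qed.

(* [expR ((t/4)^2/2)] is itself the Gaussian average of [expR (g t / 4)], so
   exchanging the two integrals reduces the claim to the mgf. *)
Lemma gaussian_vector_expR_sqr (v : 'cV[R]_n) :
  \sum_i v i 0 ^+ 2 <= 4 ->
  (\int[P]_w (expR (tdot v (X w) ^+ 2 / 32))%:E <= 2%:E)%E.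
Proof.
move=> v4.
pose f (p : T * R) : \bar R := (expR (p.2 / 4 * tdot v (X p.1)))%:E.
have mf : measurable_fun [set: T * R] f.
  apply/measurable_EFinP; apply: measurableT_comp => //.
  apply: measurable_funM; first exact: measurable_funM.
  apply: measurableT_comp; first exact: measurable_tdot.
  exact: measurableT_comp.
rewrite (eq_integral (fun w => \int[normal_prob 0 1]_y f (w, y))%E); last first.
  move=> w _; rewrite /f/=.
  have -> : (\int[normal_prob 0 1]_y (expR (y / 4 * tdot v (X w)))%:E =
             \int[normal_prob 0 1]_y (expR (tdot v (X w) / 4 * y))%:E)%E.
    by apply: eq_integral => y _; congr (expR _)%:E; ring.
  by rewrite normal_mgf; congr (expR _)%:E; field.
rewrite fubini_tonelli//; last by move=> p; rewrite lee_fin expR_ge0.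
rewrite -integral_expR_sqr_normal; apply: ge0_le_integral => //.
- by move=> y _; apply: integral_ge0 => w _; rewrite lee_fin expR_ge0.
- by apply: measurable_fun_fubini_tonelli_G => // p; rewrite lee_fin expR_ge0.
- apply/measurable_EFinP; apply: measurableT_comp => //.
  by apply: measurable_funM => //; exact: measurable_funX.
(* The mgf at [y / 4] has exponent at most [(y / 4) ^+ 2 * 4 / 2 = y ^+ 2 / 8], which is below
   [3 / 8 * y ^+ 2]. *)
- move=> y _; rewrite /f/= gaussian_vector_mgf lee_fin ler_expR.
  have := sqr_ge0 y; have := ler_wpM2l (sqr_ge0 y) v4; lra.
Qed.
End gaussian_vector.

(** * The truncated quartic and its exponential moments *)

(* A convex surrogate for [t ^+ 2 * Num.min (t ^+ 2) (M ^+ 2)]. *)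
Definition psi (R : realType) (M t : R) : R := t ^+ 4 / (1 + t ^+ 2 / M ^+ 2).

Section psi_theory.
Context (R : realType) (M : R).
Hypothesis M1 : 1 <= M.

Let M0 : 0 < M. Proof. exact: lt_le_trans M1. Qed.
Let M20 : 0 < M ^+ 2. Proof. exact: exprn_gt0. Qed.

Let den1 (t : R) : 1 <= 1 + t ^+ 2 / M ^+ 2.
Proof. by rewrite lerDl divr_ge0 ?sqr_ge0// ltW. Qed.

Let den0 (t : R) : 0 < 1 + t ^+ 2 / M ^+ 2.
Proof. exact: lt_le_trans (den1 t). Qed.

Lemma psi_ge0 (t : R) : 0 <= psi M t.
Proof. by rewrite divr_ge0 ?(ltW (den0 t))// exprn_even_ge0. Qed.

Lemma psi_le_pow4 (t : R) : psi M t <= t ^+ 4.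
Proof. by rewrite ler_pdivrMr// ler_peMr ?exprn_even_ge0. Qed.

Lemma psi_le_sqr (t : R) : psi M t <= M ^+ 2 * t ^+ 2.
Proof.
rewrite ler_pdivrMr// mulrDr mulr1.
have -> : M ^+ 2 * t ^+ 2 * (t ^+ 2 / M ^+ 2) = t ^+ 4.
  by field; rewrite gt_eqF.
by rewrite lerDr mulr_ge0 ?sqr_ge0.
Qed.

Lemma pow4_le_psi (t : R) : t ^+ 4 = (1 + t ^+ 2 / M ^+ 2) * psi M t.
Proof. by rewrite /psi mulrCA mulfV ?mulr1// gt_eqF. Qed.

(** For [t ^+ 2 > 1] the denominator of [psi] is at most [2 * t ^+ 2], because [M >= 1]. Through
    this a bound on [psi] also controls second moments. *)
Lemma sqr_le_psi (t : R) : t ^+ 2 <= 1 + 2 * psi M t.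
Proof.
have [t1|t1] := leP (t ^+ 2) 1.
  by rewrite (le_trans t1)// lerDl mulr_ge0// psi_ge0.
suff : t ^+ 2 / 2 <= psi M t by lra.
have M21 : 1 <= M ^+ 2 by rewrite exprn_ege1.
rewrite ler_pdivlMr//.
have tM : t ^+ 2 / M ^+ 2 <= t ^+ 2 by rewrite ler_pdivrMr// ler_peMr ?sqr_ge0.
have h : t ^+ 2 / 2 * (1 + t ^+ 2 / M ^+ 2) <= t ^+ 2 / 2 * (t ^+ 2 + t ^+ 2).
  by rewrite ler_wpM2l ?divr_ge0 ?sqr_ge0// lerD// ltW.
by rewrite (le_trans h)// le_eqVlt; apply/orP; left; apply/eqP; field.
Qed.

(* With [r = t ^+ 2] and [c = M ^- 2], the convex function [r ^+ 2 / (1 + c * r)]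
   exceeds its tangent at [r0] by
   [(r - r0) ^+ 2 / ((1 + c * r) * (1 + c * r0) ^+ 2)]. *)
Lemma psi_support (t0 : R) :
  exists g : R, forall t, psi M t0 + g * (t - t0) <= psi M t.
Proof.
set c := (M ^+ 2)^-1.
have c0 : 0 < c by rewrite invr_gt0.
have d0 (t : R) : 0 < 1 + t ^+ 2 * c by exact: den0.
pose b := (2 * t0 ^+ 2 + c * (t0 ^+ 2) ^+ 2) / (1 + t0 ^+ 2 * c) ^+ 2.
exists (b * (2 * t0)) => t.
have b0 : 0 <= b.
  by rewrite divr_ge0 ?exprn_even_ge0// addr_ge0// mulr_ge0// ?exprn_even_ge0// ltW.
have E : psi M t = psi M t0 + b * (t ^+ 2 - t0 ^+ 2) +
    (t ^+ 2 - t0 ^+ 2) ^+ 2 / ((1 + t ^+ 2 * c) * (1 + t0 ^+ 2 * c) ^+ 2).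
  by rewrite /psi -/c /b; field; rewrite !gt_eqF.
rewrite E -addrA lerD2l -mulrA.
apply: (@le_trans _ _ (b * (t ^+ 2 - t0 ^+ 2))).
  by rewrite ler_wpM2l//; have := sqr_ge0 (t - t0); lra.
rewrite lerDl divr_ge0 ?sqr_ge0//.
by rewrite mulr_ge0 ?exprn_even_ge0// ltW.
Qed.

Lemma measurable_psi : measurable_fun [set: R] (psi M).
Proof.
apply: continuous_measurable_fun => t.
apply: cvgM.
  by apply: (@exprn_continuous R 4).
apply: cvgV; first by rewrite gt_eqF.
apply: cvgD; first exact: cvg_cst.
by apply: cvgM; [exact: exprn_continuous|exact: cvg_cst].
Qed.

Lemma expR_ge_sqr (y : R) : 0 <= y -> y ^+ 2 / 4 <= expR y.
Proof.
move=> y0; have -> : expR y = expR (y / 2) ^+ 2.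
  by rewrite -expRM_natl; congr expR; field.
have h : y / 2 <= expR (y / 2) by have := expR_ge1Dx (y / 2); lra.
have -> : y ^+ 2 / 4 = (y / 2) ^+ 2 by field.
by rewrite ler_sqr// nnegrE ?expR_ge0// divr_ge0.
Qed.

Lemma expR_le1D (y : R) : 0 <= y -> expR y <= 1 + y * expR y.
Proof.
move=> y0; have := expR_ge1Dx (- y).
have := expR_gt0 y => e0.
move=> /(ler_wpM2r (ltW e0)); rewrite -expRD addNr expR0; lra.
Qed.

(** Small enough that [lam * psi M t <= t ^+ 2 / 64], which keeps the exponential moment of a
    Gaussian [t] finite. *)
Let lam := (64 * M ^+ 2)^-1.

(** Apply [expR y <= 1 + y * expR y] to [y = lam * psi M t]: the exponential is at most
    [expR (t ^+ 2 / 64)] and the prefactor at most [lam * t ^+ 4], where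
    [t ^+ 4 <= 128 ^+ 2 * expR (t ^+ 2 / 64)]. The excess over [1] is proportional to [lam], which
    is what makes the final threshold independent of [M]. *)
Lemma expR_psi (t : R) :
  expR (lam * psi M t) <= 1 + 128 ^+ 2 * lam * expR (t ^+ 2 / 32).
Proof.
have lam0 : 0 < lam by rewrite invr_gt0 mulr_gt0.
have h1 : lam * psi M t <= t ^+ 2 / 64.
  have -> : t ^+ 2 / 64 = lam * (M ^+ 2 * t ^+ 2).
    by rewrite /lam; field; rewrite gt_eqF.
  by rewrite ler_pM2l// psi_le_sqr.
have h2 : t ^+ 4 <= 128 ^+ 2 * expR (t ^+ 2 / 64).
  have := @expR_ge_sqr (t ^+ 2 / 64); rewrite divr_ge0 ?sqr_ge0// => /(_ isT).
  lra.
have p0 := psi_ge0 t.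
apply: (le_trans (expR_le1D (mulr_ge0 (ltW lam0) p0))); rewrite lerD2l.
have -> : expR (t ^+ 2 / 32) = expR (t ^+ 2 / 64) * expR (t ^+ 2 / 64).
  by rewrite -expRD; congr expR; field.
rewrite [leRHS](_ : _ =
  lam * (128 ^+ 2 * expR (t ^+ 2 / 64)) * expR (t ^+ 2 / 64)); last by ring.
apply: ler_pM => //; rewrite ?expR_ge0 ?ler_expR//.
  by rewrite mulr_ge0// ltW.
by rewrite ler_pM2l// (le_trans (psi_le_pow4 t)).
Qed.

End psi_theory.

(** * Chernoff bound for the sums of [psi] at a fixed vector *)

Section chernoff.
Context (d : measure_display) (T : measurableType d) (R : realType)
  (P : probability T R) (n m : nat) (a : 'I_m -> {RV P >-> n.-tuple R}) (M : R).
Hypotheses (M1 : 1 <= M) (ga : forall k, std_gaussian_vector (a k))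
  (ia : mutually_independent a).

Definition psi_sum (v : 'cV[R]_n) (w : T) : R :=
  \sum_k psi M (tdot v (a k w)).

Let lam := (64 * M ^+ 2)^-1.
Let lam0 : 0 < lam.
Proof. by rewrite invr_gt0 mulr_gt0// exprn_gt0// (lt_le_trans _ M1). Qed.

Let mpsit (v : 'cV[R]_n) :
  measurable_fun [set: n.-tuple R] (fun t => psi M (tdot v t)).
Proof.
exact: (measurableT_comp (measurable_psi M) (measurable_tdot v)).
Qed.

Let mexp (v : 'cV[R]_n) :
  measurable_fun [set: n.-tuple R] (fun t => expR (lam * psi M (tdot v t))).
Proof.
apply: measurableT_comp; first exact: measurable_expR.
apply: measurable_funM; [exact: measurable_cst|exact: mpsit].
Qed.

Lemma measurable_psi_sum (v : 'cV[R]_n) : measurable_fun [set: T] (psi_sum v).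
Proof.
apply: measurable_sum => k.
exact: (measurableT_comp (mpsit v) (measurable_funPT (a k))).
Qed.

(** Integrate [expR_psi], whose last term has mean at most [2 * 128 ^+ 2 * lam]; then
    [1 + y <= expR y] gives a form that multiplies well over [k]. *)
Lemma integral_expR_psi (v : 'cV[R]_n) (k : 'I_m) : \sum_i v i 0 ^+ 2 <= 4 ->
  (\int[P]_w (expR (lam * psi M (tdot v (a k w))))%:E <=
   (expR (2 * 128 ^+ 2 * lam))%:E)%E.
Proof.
move=> v4.
have mE : measurable_fun [set: T]
    (fun w => (128 ^+ 2 * lam)%:E * (expR (tdot v (a k w) ^+ 2 / 32))%:E)%E.
  apply/measurable_EFinP; apply: measurable_funM => //.
  apply: measurableT_comp => //; apply: measurable_funM => //.
  apply: measurable_funX.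
  exact: (measurableT_comp (measurable_tdot v) (measurable_funPT (a k))).
have mE' : measurable_fun [set: T]
    (fun w => (expR (tdot v (a k w) ^+ 2 / 32))%:E).
  apply/measurable_EFinP; apply: measurableT_comp => //.
  apply: measurable_funM => //; apply: measurable_funX.
  exact: (measurableT_comp (measurable_tdot v) (measurable_funPT (a k))).
have c0 : 0 <= 128 ^+ 2 * lam by rewrite mulr_ge0// ltW.
apply: (@le_trans _ _ (\int[P]_w
    (1 + (128 ^+ 2 * lam)%:E * (expR (tdot v (a k w) ^+ 2 / 32))%:E))%E).
  apply: ge0_le_integral => //.
  - apply/measurable_EFinP.
    exact: (measurableT_comp (mexp v) (measurable_funPT (a k))).
  - exact: emeasurable_funD.
  - by move=> w _; rewrite -EFinM -EFinD lee_fin expR_psi.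
rewrite ge0_integralD//; last first.
  by move=> w _; rewrite -EFinM lee_fin mulr_ge0// expR_ge0.
have -> : (\int[P]_(_ in [set: T]) 1 = 1)%E.
  by rewrite integral_cst// mul1e; exact: probability_setT.
rewrite ge0_integralZl//.
apply: (@le_trans _ _ (1 + (128 ^+ 2 * lam)%:E * 2%:E))%E.
  rewrite leeD2l// lee_wpmul2l// ?lee_fin//.
  exact: gaussian_vector_expR_sqr (ga k) _ v4.
rewrite -EFinM -EFinD lee_fin (le_trans _ (expR_ge1Dx _))//; lra.
Qed.

(** The exponential moment costs [2 * 128 ^+ 2 * lam] per sample and Markov's inequality gains twice
    that. Only the rate depends on [M], not the threshold. The radius [2] allowed for [v] is that of
    the net below. *)
Lemma psi_sum_chernoff (v : 'cV[R]_n) : \sum_i v i 0 ^+ 2 <= 4 ->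
  (P [set w | (m%:R * (4 * 128 ^+ 2) < psi_sum v w)%R]
   <= (expR (- (2 * 128 ^+ 2 * lam) * m%:R))%:E)%E.
Proof.
move=> v4; set A := [set w | _].
have mA : measurable A.
  rewrite /A (_ : [set w | _] = psi_sum v @^-1` `]m%:R * (4 * 128 ^+ 2), +oo[).
    by rewrite -[X in measurable X]setTI; exact: measurable_psi_sum.
  by apply/seteqP; split => w /=; rewrite in_itv/= andbT.
pose c := expR (lam * (m%:R * (4 * 128 ^+ 2))).
have c0 : 0 < c by exact: expR_gt0.
have mes : measurable_fun [set: T] (fun w => (expR (lam * psi_sum v w))%:E).
  apply/measurable_EFinP; apply: measurableT_comp => //.
  by apply: measurable_funM => //; exact: measurable_psi_sum.
have markov : (c%:E * P A <= \int[P]_w (expR (lam * psi_sum v w))%:E)%E.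
  have mi : measurable_fun [set: T] (fun w => (\1_A w : R)%:E).
    by apply/measurable_EFinP; exact: measurable_indic.
  have -> : (c%:E * P A = \int[P]_w (c%:E * (\1_A w)%:E))%E.
    rewrite ge0_integralZl//; first by rewrite integral_indic// setIT.
    by rewrite lee_fin ltW.
  apply: ge0_le_integral => //.
  - by move=> w _; rewrite -EFinM lee_fin mulr_ge0// ltW.
  - exact: measurable_funeM.
  - move=> w _; rewrite -EFinM lee_fin indicE.
    have [/set_mem wA|_] := boolP (w \in A); last by rewrite mulr0 expR_ge0.
    by rewrite mulr1 ler_expR ler_pM2l// ltW.
have mgf : (\int[P]_w (expR (lam * psi_sum v w))%:E <=
            (expR (2 * 128 ^+ 2 * lam * m%:R))%:E)%E.
  pose g (k : 'I_m) (t : n.-tuple R) := expR (lam * psi M (tdot v t)).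
  have gk k : (\int[distribution P (a k)]_t (g k t)%:E <=
               (expR (2 * 128 ^+ 2 * lam))%:E)%E.
    rewrite ge0_integral_distribution.
    - exact: integral_expR_psi.
    - by apply/measurable_EFinP; exact: mexp.
    - by move=> t; rewrite lee_fin expR_ge0.
  rewrite (eq_integral (fun w => (\prod_k g k (a k w))%:E)); last first.
    by move=> w _; rewrite /g -expR_sum mulr_sumr.
  rewrite (integral_prod_indep (Q := fun k => distribution P (a k))).
  - have -> : (expR (2 * 128 ^+ 2 * lam * m%:R))%:E =
              (\prod_(k < m) (expR (2 * 128 ^+ 2 * lam))%:E)%E.
      rewrite prodEFin -expR_sum; congr (expR _)%:E.
      by rewrite sumr_const card_ord mulr_natr.
    (* Multiplying inequalities requires nonnegative factors, so nonnegativity is carried through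
       the induction. *)
    suff /andP[] : (0 <= \prod_k \int[distribution P (a k)]_t (g k t)%:E <=
      \prod_(k < m) (expR (2 * 128 ^+ 2 * lam))%:E)%E by [].
    apply: (big_ind2 (fun x y => (0 <= x <= y)%E)) => [|x y x' y'|k _].
    - by rewrite lee_fin ler01 lexx.
    - by move=> /andP[? ?] /andP[? ?]; rewrite mule_ge0//= lee_pmul.
    - by rewrite gk andbT; apply: integral_ge0 => t _; rewrite lee_fin expR_ge0.
  - by move=> k; exact: measurable_funPT.
  - move=> B mB; have := ia (finset (fun=> true)) mB.
    rewrite (_ : \bigcap_(i in _) _ = [set w | forall k, B k (a k w)]).
      by move=> ->; apply: eq_bigl => k; rewrite inE.
    by apply/seteqP; split=> w /= H k; [apply: H; rewrite /= inE|move=> _; exact: H].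
  - by move=> k; exact: mexp.
  - by move=> k t; exact: expR_ge0.
  - by move=> k; rewrite (le_lt_trans (gk k))// ltry.
have := le_trans markov mgf.
rewrite muleC -lee_pdivlMr// => /le_trans; apply.
rewrite -EFinM lee_fin /c -expRN -expRD ler_expR; lra.
Qed.

End chernoff.

(** * Uniformity over the unit ball *)

Section lattice_net.
Context (R : realType) (n : nat).

(** A grid of mesh [1 / sqrt n], each coordinate coded by a sign and an absolute value; that zero
    has two codes only enlarges the count. Capping the absolute values at [4 * n] loses no point of
    norm at most [2], since [j <= j ^ 2]. *)
Definition lattice_point (f : {ffun 'I_n -> bool * 'I_(4 * n).+1}) : 'cV[R]_n :=
  \col_i ((-1) ^+ (f i).1 * (f i).2%:R / Num.sqrt n%:R).

Definition in_net (f : {ffun 'I_n -> bool * 'I_(4 * n).+1}) : bool :=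
  (\sum_i (f i).2 ^ 2 <= 4 * n)%N.

Lemma lattice_point_sqr f : (0 < n)%N -> in_net f ->
  \sum_i lattice_point f i 0 ^+ 2 <= 4.
Proof.
move=> n0 fn; have n0' : 0 < n%:R :> R by rewrite ltr0n.
rewrite (eq_bigr (fun i => ((f i).2 ^ 2)%:R / n%:R)); last first.
  move=> i _; rewrite mxE !exprMn exprVn sqr_sqrtr ?ler0n//.
  by rewrite sqrr_sign mul1r natrX.
by rewrite -mulr_suml -natr_sum ler_pdivrMr// -natrM ler_nat.
Qed.

Lemma sum_half_le (N : nat) : \sum_(j < N) (2^-1 : R) ^+ j <= 2.
Proof.
suff -> : \sum_(j < N) (2^-1 : R) ^+ j = 2 - 2 * 2^-1 ^+ N.
  by rewrite gerBl mulr_ge0// exprn_ge0.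
elim: N => [|N IH]; first by rewrite big_ord0 expr0; ring.
by rewrite big_ord_recr/= IH exprS; field.
Qed.

(* A point of the net has [\sum_i j_i <= \sum_i j_i ^ 2 <= 4n], hence weight
   [\prod_i 2 ^- j_i >= 2 ^- (4n)], while the weights of all points sum to at
   most [4 ^ n]. *)
Lemma card_net : \sum_(f | in_net f) (1 : R) <= 64 ^+ n.
Proof.
pose wt (f : {ffun 'I_n -> bool * 'I_(4 * n).+1}) : R :=
  \prod_i 2^-1 ^+ (f i).2.
have wt_ge f : in_net f -> 1 <= 16 ^+ n * wt f.
  move=> fn; rewrite /wt prodrXr.
  have -> : (16 : R) ^+ n = 2 ^+ (4 * n) by rewrite exprM; congr (_ ^+ _); ring.
  rewrite exprVn ler_pdivlMr ?exprn_gt0// mul1r ler_weXn2l ?ler1n//.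
  apply: leq_trans fn; apply: leq_sum => i _.
  by case: (nat_of_ord _) => // k; rewrite expnS expn1 leq_pmulr.
have wt_sum : \sum_f wt f <= 4 ^+ n.
  rewrite /wt -(bigA_distr_bigA
    (fun (_ : 'I_n) (p : bool * 'I_(4 * n).+1) => (2^-1 : R) ^+ p.2)).
  rewrite prodr_const card_ord; apply: lerXn2r.
  - by rewrite nnegrE sumr_ge0// => p _; rewrite exprn_ge0.
  - by rewrite nnegrE.
  - rewrite -(pair_bigA _ (fun (b : bool) (j : 'I_(4 * n).+1) => (2^-1 : R) ^+ j))/=.
    rewrite big_bool/=.
    have := sum_half_le (4 * n).+1; lra.
apply: (@le_trans _ _ (\sum_f 16 ^+ n * wt f)).
  rewrite big_mkcond/=; apply: ler_sum => f _.
  case: ifP => [/wt_ge//|_]; rewrite mulr_ge0 ?exprn_ge0//.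
  by apply: prodr_ge0 => i _; rewrite exprn_ge0.
rewrite -mulr_sumr; have -> : (64 : R) = 16 * 4 by ring.
by rewrite exprMn ler_pM2l// exprn_gt0.
Qed.

(* From [w], rounding each coordinate in the direction given by the sign of the
   supporting functional does not decrease [F]. *)
Lemma net_sup (F : 'cV[R]_n -> R) (B : R) : (0 < n)%N ->
  (forall w, exists q : 'cV[R]_n, forall v : 'cV[R]_n,
    F w + \sum_i q i 0 * (v i 0 - w i 0) <= F v) ->
  (forall f, in_net f -> F (lattice_point f) <= B) ->
  forall w : 'cV[R]_n, \sum_i w i 0 ^+ 2 <= 1 -> F w <= B.
Proof.
move=> n0 Fsup FB w w1.
have n0' : 0 < n%:R :> R by rewrite ltr0n.
have s0 : 0 < Num.sqrt n%:R :> R by rewrite sqrtr_gt0.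
have [q Fq] := Fsup w.
pose y i := Num.sqrt n%:R * w i 0.
pose p i : int := Num.floor (y i) + (0 <= q i 0)%R%:Z.
pose v : 'cV[R]_n := \col_i ((p i)%:~R / Num.sqrt n%:R).
have py i : (p i)%:~R - y i <= 1 /\ y i - (p i)%:~R <= 1.
  have := floor_le (y i); have := floorD1_gt (y i).
  rewrite /p !intrD.
  by case: (0 <= q i 0)%R => /=; rewrite ?mulr1z ?mulr0z; split; lra.
have qpy i : 0 <= q i 0 * (v i 0 - w i 0).
  have -> : v i 0 - w i 0 = ((p i)%:~R - y i) / Num.sqrt n%:R.
    by rewrite mxE /y; field; rewrite gt_eqF.
  rewrite mulrA divr_ge0 ?(ltW s0)//.
  have := floor_le (y i); have := floorD1_gt (y i).
  rewrite /p !intrD; have [q0|q0] := leP 0 (q i 0);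
    rewrite ?mulr1z ?mulr0z => h1 h2.
    by rewrite mulr_ge0// subr_ge0; lra.
  by rewrite mulr_le0 ?(ltW q0)//; lra.
(* Rounding moves a coordinate by at most [1], so [p ^+ 2 <= 2 * y ^+ 2 + 2]; summed over [i] this
   is at most [2 * n + 2 * n], which fixes the radius of the net. *)
have p4 : \sum_i ((p i)%:~R : R) ^+ 2 <= (4 * n)%:R.
  apply: (@le_trans _ _ (\sum_i (2 * (n%:R * w i 0 ^+ 2) + 2))).
    apply: ler_sum => i _.
    have -> : n%:R * w i 0 ^+ 2 = y i ^+ 2.
      by rewrite /y exprMn sqr_sqrtr.
    have [h1 h2] := py i.
    have h : ((p i)%:~R - y i) ^+ 2 <= 1 by nra.
    have := sqr_ge0 ((p i)%:~R - 2 * y i); nra.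
  rewrite big_split/= -!mulr_sumr sumr_const card_ord.
  rewrite natrM -mulr_natl.
  have := ler_wpM2l (ltW n0') w1; lra.
have pabs i : (`|p i| ^ 2)%N%:R = ((p i)%:~R : R) ^+ 2.
  by rewrite natrX natr_absz intr_norm real_normK ?num_real.
have p4' : (\sum_i `|p i| ^ 2 <= 4 * n)%N.
  by rewrite -(ler_nat R) natr_sum (eq_bigr _ (fun i _ => pabs i)).
have pN i : (`|p i| < (4 * n).+1)%N.
  rewrite ltnS (leq_trans _ p4')// (bigD1 i)//=.
  rewrite (leq_trans _ (leq_addr _ _))//.
  by case: (`|p i|)%N => // k; rewrite expnS expn1 leq_pmulr.
pose f : {ffun 'I_n -> bool * 'I_(4 * n).+1} :=
  [ffun i => (p i < 0, Ordinal (pN i))].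
have fv : lattice_point f = v.
  apply/matrixP => i j; rewrite !mxE ffunE/=; congr (_ / _).
  by rewrite [in RHS](intEsign (p i)) rmorphM/= rmorph_sign.
have fn : in_net f by rewrite /in_net; under eq_bigr do rewrite ffunE/=.
apply: (le_trans _ (FB f fn)); rewrite fv; apply: le_trans (Fq v).
by rewrite lerDl sumr_ge0.
Qed.

End lattice_net.

Lemma probability_bigsetU_le (d : measure_display) (T : measurableType d)
    (R : realType) (P : probability T R) (I : finType) (Q : pred I)
    (A : I -> set T) (b : R) :
  (forall i, Q i -> measurable (A i)) ->
  (forall i, Q i -> P (A i) <= b%:E)%E ->
  (P (\big[setU/set0]_(i | Q i) A i) <= (\sum_(i | Q i) b)%:E)%E.
Proof.
move=> mA PA.
suff [] : measurable (\big[setU/set0]_(i | Q i) A i) /\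
  (P (\big[setU/set0]_(i | Q i) A i) <= (\sum_(i | Q i) b)%:E)%E by [].
apply: (big_ind2 (fun B x => measurable B /\ (P B <= x%:E)%E)).
- by rewrite measure0.
- move=> B x C y [mB PB] [mC PC]; split; first exact: measurableU.
  by rewrite (le_trans (measureU2 _ mB mC))// EFinD leeD.
- by move=> i Qi; split; [exact: mA|exact: PA].
Qed.

(** A union bound over the net, with [psi_sum_chernoff] at each point; [net_sup] passes from the net
    to the ball. *)
Lemma uniform_psi_sum (R : realType) (M : R) : 1 <= M ->
  exists C c : R, [/\ 0 < C, 0 < c &
  forall (n m : nat), (0 < n)%N -> C * n%:R <= m%:R ->
  forall (d : measure_display) (T : measurableType d) (P : probability T R)
    (a : 'I_m -> {RV P >-> n.-tuple R}),
  (forall k, std_gaussian_vector (a k)) -> mutually_independent a ->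
  prob_exceeds P (1 - expR (- c * m%:R))
    [set w | forall v : 'cV[R]_n, \sum_i v i 0 ^+ 2 <= 1 ->
      psi_sum a M v w <= m%:R * (4 * 128 ^+ 2)]].
Proof.
move=> M1; have M0 : 0 < M by exact: lt_le_trans M1.
pose kappa := 2 * 128 ^+ 2 * (64 * M ^+ 2)^-1.
have k0 : 0 < kappa by rewrite /kappa divr_gt0// ?mulr_gt0// exprn_gt0.
(* This [C] gives [64 * n <= kappa / 2 * m], so the at most [64 ^+ n <= expR (64 * n)] net points
   consume half of the rate [kappa]. Keeping [kappa / 4] of the other half leaves room for a strict
   inequality. *)
exists (128 / kappa), (kappa / 4); split; [exact: divr_gt0|exact: divr_gt0|].
move=> n m n0 nm d T P a ga ia.
have m0 : 0 < m%:R :> R.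
  by apply: lt_le_trans nm; rewrite mulr_gt0 ?ltr0n// divr_gt0.
pose A f := [set w | m%:R * (4 * 128 ^+ 2) < psi_sum a M (lattice_point R f) w].
have mA f : measurable (A f).
  rewrite /A (_ : [set w | _] =
      psi_sum a M (lattice_point R f) @^-1` `]m%:R * (4 * 128 ^+ 2), +oo[).
    by rewrite -[X in measurable X]setTI; exact: measurable_psi_sum.
  by apply/seteqP; split => w /=; rewrite in_itv/= andbT.
pose B := \big[setU/set0]_(f | @in_net n f) A f.
have mB : measurable B by apply: bigsetU_measurable => f _; exact: mA.
exists (~` B); split; first exact: measurableC.
  move=> w wB v v1.
  apply: (net_sup n0 (F := fun v => psi_sum a M v w)) v1 => [u|f fn].
    (* Each summand is [psi M] of a linear form, so the slopes [q k] combine into the supporting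
       functional with vector [\sum_k q k * a_k]. *)
    have /choice[q Hq] : forall k, exists q : R, forall t,
        psi M (tdot u (a k w)) + q * (t - tdot u (a k w)) <= psi M t.
      by move=> k; exact: psi_support.
    exists (\col_i \sum_k q k * tnth (a k w) i) => v'.
    suff -> : \sum_i (\col_i \sum_k q k * tnth (a k w) i) i 0 * (v' i 0 - u i 0)
        = \sum_k q k * (tdot v' (a k w) - tdot u (a k w)).
      by rewrite /psi_sum -big_split/=; apply: ler_sum => k _; exact: Hq.
    under eq_bigr do rewrite mxE mulr_suml.
    rewrite exchange_big/=; apply: eq_bigr => k _.
    rewrite /tdot -sumrB mulr_sumr; apply: eq_bigr => i _; ring.
  rewrite leNgt; apply/negP => wA; apply: wB.
  by rewrite /B (bigD1 f)//=; left.
rewrite probability_setC//.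
have PB : (P B <= (expR (- (kappa / 2) * m%:R))%:E)%E.
  apply: le_trans (probability_bigsetU_le (b := expR (- kappa * m%:R)) _ _) _.
  - by move=> f _; exact: mA.
  - by move=> f fn; exact: (psi_sum_chernoff M1 ga ia (lattice_point_sqr _ n0 fn)).
  rewrite lee_fin.
  apply: (@le_trans _ _ (64 ^+ n * expR (- kappa * m%:R))).
    rewrite (eq_bigr (fun=> 1 * expR (- kappa * m%:R))); last first.
      by move=> f _; rewrite mul1r.
    by rewrite -mulr_suml ler_wpM2r ?expR_ge0// card_net.
  apply: (@le_trans _ _ (expR 64 ^+ n * expR (- kappa * m%:R))).
    rewrite ler_wpM2r ?expR_ge0// lerXn2r// ?nnegrE ?expR_ge0//.
    by have := expR_ge1Dx (64 : R); lra.
  rewrite -expRM_natl -expRD ler_expR.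
  have : 64 * n%:R <= kappa / 2 * m%:R.
    have := ler_wpM2l (ltW k0) nm.
    rewrite mulrA (_ : kappa * (128 / kappa) = 128); last by field; rewrite gt_eqF.
    lra.
  rewrite -mulr_natl; lra.
have PBf : P B = (fine (P B))%:E by rewrite fineK// fin_num_measure.
move: PB; rewrite PBf lee_fin => PB.
rewrite -EFinB lte_fin ltrD2l ltrN2 (le_lt_trans PB)// ltr_expR.
have := mulr_gt0 k0 m0; lra.
Qed.

(** * Frobenius norm and the tangent projection *)

(** Lagrange's identity: the difference of the two sides is half a sum of squares. *)
Lemma sum_cauchy_schwarz (R : realType) (I : finType) (x y : I -> R) :
  (\sum_i x i * y i) ^+ 2 <= (\sum_i x i ^+ 2) * (\sum_i y i ^+ 2).
Proof.
rewrite -subr_ge0.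
have -> : (\sum_i x i ^+ 2) * (\sum_i y i ^+ 2) - (\sum_i x i * y i) ^+ 2 =
    2^-1 * \sum_i \sum_j (x i * y j - x j * y i) ^+ 2.
  have E1 : (\sum_i x i ^+ 2) * (\sum_i y i ^+ 2) =
      \sum_i \sum_j x i ^+ 2 * y j ^+ 2.
    by rewrite mulr_suml; apply: eq_bigr => i _; rewrite mulr_sumr.
  have E2 : (\sum_i x i * y i) ^+ 2 = \sum_i \sum_j (x i * y i) * (x j * y j).
    by rewrite expr2 mulr_suml; apply: eq_bigr => i _; rewrite mulr_sumr.
  have E3 : \sum_i \sum_j (x i * y j - x j * y i) ^+ 2 =
      \sum_i \sum_j x i ^+ 2 * y j ^+ 2 + \sum_i \sum_j x j ^+ 2 * y i ^+ 2
      - 2 * \sum_i \sum_j (x i * y i) * (x j * y j).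
    rewrite mulr_sumr -big_split/= -sumrB; apply: eq_bigr => i _.
    rewrite mulr_sumr -big_split/= -sumrB; apply: eq_bigr => j _; ring.
  by rewrite E3 [X in _ + X - _]exchange_big/= E1 E2; field.
by rewrite mulr_ge0 ?invr_ge0// sumr_ge0// => i _; rewrite sumr_ge0// => j _;
  rewrite sqr_ge0.
Qed.

Section frobenius.
Context (R : realType).

Lemma frob_ge0 p q (A : 'M[R]_(p, q)) : 0 <= frob A.
Proof. exact: sqrtr_ge0. Qed.

Lemma frob_sqr p q (A : 'M[R]_(p, q)) : frob A ^+ 2 = \sum_i \sum_j A i j ^+ 2.
Proof.
by rewrite sqr_sqrtr// sumr_ge0// => i _; rewrite sumr_ge0// => j _; rewrite sqr_ge0.
Qed.

Lemma frob_cauchy_schwarz p q (A B : 'M[R]_(p, q)) :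
  `|\sum_i \sum_j A i j * B i j| <= frob A * frob B.
Proof.
rewrite -(@ler_pXn2r _ 2)// ?nnegrE ?mulr_ge0 ?frob_ge0//.
rewrite real_normK ?num_real// exprMn !frob_sqr !pair_bigA/=.
exact: (sum_cauchy_schwarz (fun p => A p.1 p.2) (fun p => B p.1 p.2)).
Qed.

Lemma frobD p q (A B : 'M[R]_(p, q)) : frob (A + B) <= frob A + frob B.
Proof.
rewrite -(@ler_pXn2r _ 2)// ?nnegrE ?addr_ge0 ?frob_ge0//.
have -> : frob (A + B) ^+ 2 =
    frob A ^+ 2 + 2 * (\sum_i \sum_j A i j * B i j) + frob B ^+ 2.
  rewrite !frob_sqr mulr_sumr -!big_split/=; apply: eq_bigr => i _.
  rewrite mulr_sumr -!big_split/=; apply: eq_bigr => j _; rewrite mxE; ring.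
have := le_trans (ler_norm _) (frob_cauchy_schwarz A B); lra.
Qed.

Lemma frobZ p q (c : R) (A : 'M[R]_(p, q)) : frob (c *: A) = `|c| * frob A.
Proof.
rewrite /frob -sqrtr_sqr -sqrtrM ?sqr_ge0//; congr Num.sqrt.
rewrite mulr_sumr; apply: eq_bigr => i _; rewrite mulr_sumr.
by apply: eq_bigr => j _; rewrite mxE exprMn.
Qed.

Lemma frobN p q (A : 'M[R]_(p, q)) : frob (- A) = frob A.
Proof. by rewrite -scaleN1r frobZ normrN1 mul1r. Qed.

Lemma dotvE n (u v : 'cV[R]_n) : dotv u v = \sum_i u i 0 * v i 0.
Proof. by rewrite /dotv mxE; apply: eq_bigr => i _; rewrite mxE. Qed.

Lemma dotvC n (u v : 'cV[R]_n) : dotv u v = dotv v u.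
Proof. by rewrite !dotvE; apply: eq_bigr => i _; rewrite mulrC. Qed.

Lemma dotvBr n (u v w : 'cV[R]_n) : dotv u (v - w) = dotv u v - dotv u w.
Proof.
by rewrite !dotvE -sumrB; apply: eq_bigr => i _; rewrite !mxE mulrBr.
Qed.

Lemma dotvZr n c (u v : 'cV[R]_n) : dotv u (c *: v) = c * dotv u v.
Proof.
by rewrite !dotvE mulr_sumr; apply: eq_bigr => i _; rewrite !mxE mulrCA.
Qed.

Lemma frob_colE n (v : 'cV[R]_n) : frob v ^+ 2 = \sum_i v i 0 ^+ 2.
Proof. by rewrite frob_sqr; apply: eq_bigr => i _; rewrite big_ord1. Qed.

Lemma dotvv n (v : 'cV[R]_n) : dotv v v = frob v ^+ 2.
Proof. by rewrite frob_colE dotvE; apply: eq_bigr => i _; rewrite expr2. Qed.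

Lemma frob_col_eq0 n (v : 'cV[R]_n) : (frob v == 0) = (v == 0).
Proof.
apply/eqP/eqP => [v0|->]; last first.
  by rewrite -(scale0r 0) frobZ normr0 mul0r.
apply/matrixP => i j; rewrite (ord1 j) mxE; apply/eqP.
have := frob_colE v; rewrite v0 expr0n/= => /esym/eqP.
rewrite psumr_eq0; last by move=> k _; rewrite sqr_ge0.
by move=> /allP/(_ i); rewrite mem_index_enum sqrf_eq0 => /(_ isT).
Qed.

Lemma dotv_cauchy_schwarz n (u v : 'cV[R]_n) : `|dotv u v| <= frob u * frob v.
Proof.
have := frob_cauchy_schwarz u v.
rewrite dotvE (eq_bigr (fun i => u i 0 * v i 0))// => i _.
by rewrite big_ord1.
Qed.

Lemma outerE n (u v : 'cV[R]_n) i j : (u *m v^T) i j = u i 0 * v j 0.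
Proof. by rewrite mxE big_ord1 mxE. Qed.

Lemma frob_outer n (u v : 'cV[R]_n) : frob (u *m v^T) = frob u * frob v.
Proof.
apply/eqP; rewrite -(@eqrXn2 _ 2)// ?mulr_ge0 ?frob_ge0//.
rewrite exprMn !frob_colE frob_sqr mulr_suml; apply/eqP/eq_bigr => i _.
by rewrite mulr_sumr; apply: eq_bigr => j _; rewrite outerE exprMn.
Qed.

Lemma quad_le_frob n (W : 'M[R]_n) (u v : 'cV[R]_n) :
  `|(u^T *m W *m v) 0 0| <= frob W * (frob u * frob v).
Proof.
rewrite -frob_outer; apply: le_trans (frob_cauchy_schwarz W (u *m v^T)).
rewrite le_eqVlt; apply/orP; left; apply/eqP; congr `|_|.
rewrite mxE exchange_big/=; apply: eq_bigr => j _.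
rewrite mxE mulr_suml; apply: eq_bigr => i _.
by rewrite outerE mxE; ring.
Qed.

Lemma quad_outer n (u v y z : 'cV[R]_n) :
  (u^T *m (y *m z^T) *m v) 0 0 = dotv u y * dotv z v.
Proof. by rewrite mulmxA -mulmxA mxE big_ord1. Qed.

Lemma quadB n (u v : 'cV[R]_n) (A B : 'M[R]_n) :
  (u^T *m (A - B) *m v) 0 0 = (u^T *m A *m v) 0 0 - (u^T *m B *m v) 0 0.
Proof. by rewrite mulmxBr mulmxBl !mxE. Qed.

Lemma dotv_sumr n (I : finType) (c : I -> R) (w : I -> 'cV[R]_n)
    (q v : 'cV[R]_n) : (forall i, q i 0 = \sum_k c k * w k i 0) ->
  dotv v q = \sum_k c k * dotv (w k) v.
Proof.
move=> qE; rewrite dotvE.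
under eq_bigr do rewrite qE mulr_sumr.
rewrite exchange_big/=; apply: eq_bigr => k _.
by rewrite dotvE mulr_sumr; apply: eq_bigr => i _; rewrite mulrCA [v i 0 * _]mulrC.
Qed.

End frobenius.

(** * Second and fourth moments along arbitrary vectors *)

Section uniform_moments.
Context (R : realType) (n m : nat) (a : 'I_m -> 'cV[R]_n) (M D : R).
Hypotheses (M1 : 1 <= M) (D0 : 0 <= D)
  (aD : forall v : 'cV[R]_n, frob v <= 1 ->
    \sum_k psi M (dotv (a k) v) <= m%:R * D).

Let M0 : 0 < M. Proof. exact: lt_le_trans M1. Qed.

Let unit_frob (w : 'cV[R]_n) : w != 0 -> frob ((frob w)^-1 *: w) <= 1.
Proof.
rewrite -frob_col_eq0 => w0.
by rewrite frobZ ger0_norm ?invr_ge0 ?frob_ge0// mulVf.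
Qed.

(** Normalise [w] and use [sqr_le_psi]; this is the bound on the operator norm of
    [\sum_k a_k a_k^T]. *)
Lemma sum_dotv_sqr_le (w : 'cV[R]_n) :
  \sum_k dotv (a k) w ^+ 2 <= m%:R * (1 + 2 * D) * frob w ^+ 2.
Proof.
have [->|w0] := eqVneq w 0.
  rewrite big1 => [|k _].
    apply: mulr_ge0; last exact: sqr_ge0.
    apply: mulr_ge0; first exact: ler0n.
    by apply: addr_ge0 => //; apply: mulr_ge0.
  by rewrite -(scale0r 0) dotvZr mul0r expr0n.
have fw0 : frob w != 0 by rewrite frob_col_eq0.
set v := (frob w)^-1 *: w.
have E k : dotv (a k) w ^+ 2 = dotv (a k) v ^+ 2 * frob w ^+ 2.
  by rewrite /v dotvZr; field.
rewrite (eq_bigr _ (fun k _ => E k)) -mulr_suml ler_wpM2r ?sqr_ge0//.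
apply: (@le_trans _ _ (\sum_(k < m) (1 + 2 * psi M (dotv (a k) v)))).
  by apply: ler_sum => k _; exact: sqr_le_psi.
rewrite big_split/= -mulr_sumr sumr_const card_ord.
have := aD (unit_frob w0); rewrite -/v; lra.
Qed.

(** With [a_k . h = s * t] and [s = |h|], [pow4_le_psi] splits the fourth power into
    [s ^+ 4 * psi M t] and [s ^+ 2 * ((s * t) ^+ 2 / M ^+ 2) * psi M t]. The bound [L] enters only
    the second part, damped by [M ^- 2]. *)
Lemma sum_dotv_pow4_le (h : 'cV[R]_n) (L : R) (Q : pred 'I_m) :
  (forall k, Q k -> dotv (a k) h ^+ 2 <= L ^+ 2) ->
  \sum_(k | Q k) dotv (a k) h ^+ 4 <=
    m%:R * D * frob h ^+ 2 * (frob h ^+ 2 + L ^+ 2 / M ^+ 2).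
Proof.
move=> QL; have M20 : 0 < M ^+ 2 by exact: exprn_gt0.
have [->|h0] := eqVneq h 0.
  rewrite big1 => [|k _].
    apply: mulr_ge0; last by rewrite addr_ge0 ?divr_ge0 ?sqr_ge0.
    by apply: mulr_ge0; rewrite ?sqr_ge0// mulr_ge0.
  by rewrite -(scale0r 0) dotvZr mul0r expr0n.
have fh0 : frob h != 0 by rewrite frob_col_eq0.
set v := (frob h)^-1 *: h; set s := frob h.
have E k : dotv (a k) h = s * dotv (a k) v.
  by rewrite /v dotvZr /s; field.
pose c := s ^+ 4 + s ^+ 2 * (L ^+ 2 / M ^+ 2).
have c0 : 0 <= c.
  apply: addr_ge0; first exact: exprn_even_ge0.
  by apply: mulr_ge0; rewrite ?divr_ge0 ?sqr_ge0.
apply: (@le_trans _ _ (\sum_k c * psi M (dotv (a k) v))).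
  rewrite [leLHS]big_mkcond/=; apply: ler_sum => k _.
  case: ifP => [/QL|_]; last by rewrite mulr_ge0// psi_ge0.
  rewrite E; set t := dotv (a k) v => tL.
  rewrite exprMn [t ^+ 4](pow4_le_psi M) mulrA ler_wpM2r ?psi_ge0// /c.
  rewrite mulrDr mulr1 lerD2l.
  have -> : s ^+ 4 * (t ^+ 2 / M ^+ 2) = s ^+ 2 * ((s * t) ^+ 2 / M ^+ 2).
    by field; rewrite gt_eqF.
  by rewrite ler_wpM2l ?sqr_ge0// ler_wpM2r// invr_ge0 ltW.
rewrite -mulr_sumr.
have := ler_wpM2l c0 (aD (unit_frob h0)); rewrite -/v => /le_trans; apply.
by rewrite le_eqVlt; apply/orP; left; apply/eqP; rewrite /c; ring.
Qed.

End uniform_moments.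

(** * The projection onto the tangent space at [z] *)

Section projection.
Context (R : realType) (n : nat) (z : 'cV[R]_n).
Hypothesis z0 : z != 0.

Let u := (frob z)^-1 *: z.

Let fz0 : frob z != 0. Proof. by rewrite frob_col_eq0. Qed.

Lemma dotv_unit : dotv u u = 1.
Proof. by rewrite /u dotvZr dotvC dotvZr dotvv; field. Qed.

Lemma frob_unit : frob u = 1.
Proof. by rewrite /u frobZ ger0_norm ?invr_ge0 ?frob_ge0// mulVf. Qed.

Lemma unitZ : z = frob z *: u.
Proof. by rewrite /u scalerA mulfV// scale1r. Qed.

Let proju (v : 'cV[R]_n) : u *m u^T *m v = dotv u v *: u.
Proof.
rewrite -mulmxA [u^T *m v]mx11_scalar mul_mx_scalar.
by congr (_ *: _); rewrite /dotv.
Qed.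

(** The complementary projection is [W] mapped to [V W V] with [V = I - u u^T], and [V z = 0],
    [V x = h]. *)
Lemma sub_projT_outer (x : 'cV[R]_n) :
  let h := x - dotv u x *: u in
  (z *m z^T - x *m x^T) - projT z (z *m z^T - x *m x^T) = - (h *m h^T).
Proof.
move=> h.
pose V := 1%:M - u *m u^T : 'M[R]_n.
have -> (W : 'M[R]_n) : W - projT z W = V *m W *m V.
  rewrite /projT -/u /V; set U := u *m u^T.
  rewrite [RHS]mulmxBr mulmx1 !mulmxBl !mul1mx -[RHS]addrA -opprD.
  by rewrite addrA.
have Vz : V *m z = 0.
  rewrite /V mulmxBl mul1mx {1}unitZ [in X in _ - X]unitZ -scalemxAr proju.
  by rewrite dotv_unit scale1r subrr.
have Vx : V *m x = h by rewrite /V mulmxBl mul1mx proju.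
have VT : V^T = V by rewrite /V linearB/= trmx1 trmx_mul trmxK.
have VW : V *m (z *m z^T - x *m x^T) = - (h *m x^T).
  by rewrite mulmxBr !(mulmxA V) Vz mul0mx sub0r Vx.
by rewrite VW mulNmx -mulmxA -Vx trmx_mul VT.
Qed.

(** With [q = S u], symmetry gives [P_T S = u q^T + q u^T - (u . q) u u^T], three terms of norm at
    most [|q|]. *)
Lemma frob_projT_le (S : 'M[R]_n) : S^T = S -> frob (projT z S) <= 3 * frob (S *m u).
Proof.
move=> ST; set q := S *m u.
have -> : projT z S = u *m q^T + q *m u^T - dotv u q *: (u *m u^T).
  rewrite /projT -/u; congr (_ + _ - _).
  - by rewrite /q trmx_mul ST mulmxA.
  - by rewrite /q mulmxA.
  - by rewrite mulmxA -(mulmxA (u *m u^T)) -/q proju -scalemxAl.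
rewrite (le_trans (frobD _ _))// frobN frobZ !frob_outer frob_unit !mul1r mulr1.
have := frobD (u *m q^T) (q *m u^T); rewrite !frob_outer frob_unit mul1r mulr1.
by have := dotv_cauchy_schwarz u q; rewrite frob_unit mul1r; lra.
Qed.

End projection.

(** * The truncated operator *)

Section truncated_operator.
Context (R : realType) (tau_x tau_z tau_h : R) (n m : nat)
  (a : 'I_m -> 'cV[R]_n) (M D : R) (x z : 'cV[R]_n) (eps0 : R).
Hypotheses (tau_x0 : 0 < tau_x) (tau_z0 : 0 < tau_z) (m0 : (0 < m)%N)
  (M1 : 1 <= M) (D0 : 0 <= D)
  (aD : forall v : 'cV[R]_n, frob v <= 1 ->
    \sum_k psi M (dotv (a k) v) <= m%:R * D)
  (x0 : x != 0) (eps0_ge0 : 0 <= eps0) (eps0_lt1 : eps0 < 1).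

Let W := z *m z^T - x *m x^T.

Hypothesis Weps : frob W <= eps0 * frob (x *m x^T).

Let u := (frob z)^-1 *: z.
Let h := x - dotv u x *: u.
Let K := tau_x * Num.sqrt (1 + 2 * D) + tau_z.
Let t k : R := (trunc tau_x tau_z tau_h a x z k)%:R.

Let m0R : 0 < m%:R :> R. Proof. by rewrite ltr0n. Qed.

Let D1 : 0 <= 1 + 2 * D.
Proof. by apply: addr_ge0 => //; apply: mulr_ge0. Qed.

Let fx0 : 0 < frob x.
Proof. by rewrite lt_neqAle frob_ge0 andbT eq_sym frob_col_eq0. Qed.

(** For [z = 0] the matrix [W] would be [- x x^T], too large for [eps0 < 1]. *)
Let z0 : z != 0.
Proof.
apply/eqP => z_0; move: Weps.
rewrite /W z_0 mul0mx sub0r frobN frob_outer => /le_lt_trans H.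
have /H : eps0 * (frob x * frob x) < frob x * frob x.
  by rewrite gtr_pMl// mulr_gt0.
by rewrite ltxx.
Qed.

Let fz0 : frob z != 0. Proof. by rewrite frob_col_eq0. Qed.

(** Since [z . h = 0] and [x . h = |h|^2], the form [x^T W h] equals [- (|x| |h|)^2], while it is at
    most [|W| |x| |h|] in absolute value; one factor [|x| |h|] cancels. *)
Lemma frob_residual_le : frob x * frob h <= frob W.
Proof.
have uh : dotv u h = 0.
  by rewrite /h dotvBr dotvZr (dotv_unit z0) mulr1 subrr.
have zh : dotv z h = 0.
  have -> : z = frob z *: u by exact: unitZ.
  by rewrite dotvC dotvZr dotvC uh mulr0.
have xh : dotv x h = frob h ^+ 2.
  have -> : dotv x h = dotv h x by exact: dotvC.
  by rewrite -dotvv [in RHS]/h dotvBr dotvZr [dotv _ u]dotvC uh mulr0 subr0.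
have := quad_le_frob W x h.
have -> : (x^T *m W *m h) 0 0 = - (frob x * frob h) ^+ 2.
  by rewrite /W quadB !quad_outer zh mulr0 sub0r dotvv xh exprMn.
rewrite normrN normrX expr2 ger0_norm; last by rewrite mulr_ge0 ?frob_ge0.
have [->|xh0] := eqVneq (frob x * frob h) 0; first by rewrite frob_ge0.
rewrite ler_pM2r// lt_neqAle eq_sym xh0/=.
by rewrite mulr_ge0 ?frob_ge0.
Qed.

(** [trunc1z] is the bound along [u]. [trunc1x] compares [|a_k . x|] with the root of the empirical
    mean of [y], at most [(1 + 2 * D) |x|^2] by [sum_dotv_sqr_le]; subtracting [(u . x) u] adds
    [tau_z |x|], whence [K]. *)
Let trunc_bound k : trunc tau_x tau_z tau_h a x z k ->
  `|dotv (a k) u| <= tau_z /\ `|dotv (a k) h| <= K * frob x.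
Proof.
move=> /and3P[t1x t1z _].
have au : `|dotv (a k) u| <= tau_z.
  rewrite /u dotvZr normrM ger0_norm ?invr_ge0 ?frob_ge0//.
  by rewrite ler_pdivrMl ?lt_neqAle 1?eq_sym ?fz0 ?frob_ge0// mulrC.
have ax : `|dotv (a k) x| <= tau_x * Num.sqrt (1 + 2 * D) * frob x.
  move: t1x; rewrite /trunc1x mxE sqrtr_sqr normr_id => /le_trans; apply.
  rewrite -mulrA ler_pM2l//.
  have -> : Num.sqrt (1 + 2 * D) * frob x = Num.sqrt ((1 + 2 * D) * frob x ^+ 2).
    by rewrite sqrtrM// sqrtr_sqr ger0_norm ?frob_ge0.
  rewrite ler_wsqrtr// ler_pdivrMr// mulrC mulrA.
  apply: le_trans (sum_dotv_sqr_le M1 D0 aD x).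
  by apply: ler_sum => i _; rewrite mxE normrX normr_id real_normK ?num_real.
split=> //; rewrite /h dotvBr dotvZr.
apply: (le_trans (ler_normB _ _)); rewrite /K mulrDl lerD// normrM mulrC.
apply: ler_pM => //.
have := dotv_cauchy_schwarz u x; rewrite (frob_unit z0) mul1r; exact.
Qed.

Lemma truncated_operator_bound :
  frob (projT z (adjAz tau_x tau_z tau_h a x z
         (measAz tau_x tau_z tau_h a x z (W - projT z W)))) ^+ 2 <=
  9 * tau_z ^+ 2 * (1 + 2 * D) * D * (eps0 ^+ 2 + K ^+ 2 / M ^+ 2)
  * m%:R ^+ 2 * frob W ^+ 2.
Proof.
have WE : W - projT z W = - (h *m h^T) by exact: sub_projT_outer.
set S := adjAz _ _ _ _ _ _ _.
(* The indicator occurs in both the operator and its adjoint; being idempotent, it is kept once. *)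
have tt k : t k * t k = t k.
  by rewrite /t; case: (trunc _ _ _ _ _ _ _); rewrite ?mulr1 ?mulr0.
pose b k := - dotv (a k) h ^+ 2 * t k.
have SE : S = \sum_k b k *: (a k *m (a k)^T).
  apply: eq_bigr => k _; congr (_ *: _).
  rewrite /measAz mxE [measA _ _ _ _]mxE WE -/(t k) -mulrA tt; congr (_ * _).
  by rewrite mulmxN mulNmx mxE quad_outer [dotv h _]dotvC expr2.
have ST : S^T = S.
  rewrite SE linear_sum/=; apply: eq_bigr => k _.
  by rewrite linearZ/= trmx_mul trmxK.
set q := S *m u.
have qE i : q i 0 = \sum_k b k * dotv (a k) u * a k i 0.
  have E k : (b k *: (a k *m (a k)^T) *m u) i 0 = b k * dotv (a k) u * a k i 0.
    rewrite -scalemxAl mxE -mulmxA mxE big_ord1 /dotv; ring.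
  by rewrite /q SE mulmx_suml summxE; under eq_bigr do rewrite E.
have qq : frob q ^+ 2 = \sum_k (b k * dotv (a k) u) * dotv (a k) q.
  by rewrite -dotvv; exact: dotv_sumr.
pose V := m%:R * D * frob h ^+ 2 * (frob h ^+ 2 + (K * frob x) ^+ 2 / M ^+ 2).
have V0 : 0 <= V.
  apply: mulr_ge0; last by rewrite addr_ge0 ?divr_ge0 ?sqr_ge0.
  by apply: mulr_ge0; rewrite ?sqr_ge0// mulr_ge0// ltW.
have bV : \sum_k (b k * dotv (a k) u) ^+ 2 <= tau_z ^+ 2 * V.
  apply: (@le_trans _ _ (\sum_(k | trunc tau_x tau_z tau_h a x z k)
      tau_z ^+ 2 * dotv (a k) h ^+ 4)).
    rewrite [leRHS]big_mkcond/=; apply: ler_sum => k _.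
    rewrite /b /t; case: ifP => [/trunc_bound[au _]|_]; last first.
      by rewrite mulr0 mul0r expr0n.
    rewrite mulr1 exprMn sqrrN -exprM mulrC ler_wpM2r ?exprn_even_ge0//.
    by rewrite -real_normK ?num_real// ler_pXn2r// nnegrE// ltW.
  rewrite -mulr_sumr ler_wpM2l ?sqr_ge0//.
  apply: (sum_dotv_pow4_le M1 D0 aD) => k /trunc_bound[_ ah].
  rewrite -real_normK ?num_real// ler_pXn2r// nnegrE//.
  exact: le_trans ah.
(* Cauchy-Schwarz in [qq] bounds [|q|^4] by the first sum times [\sum_k (a_k . q)^2], itself a
   multiple of [|q|^2]; divide by [|q|^2]. *)
have q_le : frob q ^+ 2 <= tau_z ^+ 2 * V * (m%:R * (1 + 2 * D)).
  have [->|q0] := eqVneq (frob q) 0.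
    rewrite expr0n/= mulr_ge0//; first by rewrite mulr_ge0 ?sqr_ge0.
    by apply: mulr_ge0.
  have q20 : 0 < frob q ^+ 2 by rewrite exprn_even_gt0.
  rewrite -(ler_pM2r q20) -expr2 {1}qq.
  apply: le_trans (sum_cauchy_schwarz _ _) _.
  rewrite -[leRHS]mulrA; apply: ler_pM => //.
  - by apply: sumr_ge0 => k _; exact: sqr_ge0.
  - by apply: sumr_ge0 => k _; exact: sqr_ge0.
  - exact: sum_dotv_sqr_le M1 D0 aD q.
have hW := frob_residual_le.
have hx : frob h <= eps0 * frob x.
  rewrite -(ler_pM2l fx0) (le_trans hW)// (le_trans Weps)// frob_outer.
  by rewrite le_eqVlt; apply/orP; left; apply/eqP; ring.
have hxW : frob x ^+ 2 * frob h ^+ 2 <= frob W ^+ 2.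
  rewrite -exprMn ler_pXn2r// nnegrE ?frob_ge0// mulr_ge0 ?frob_ge0//.
(* One factor [|h|] is traded for [eps0 |x|], so that [|x| |h| <= |W|] applies to what remains. *)
have hhW : frob h ^+ 2 * frob h ^+ 2 <= eps0 ^+ 2 * frob W ^+ 2.
  apply: (@le_trans _ _ (frob h ^+ 2 * (eps0 * frob x) ^+ 2)).
    rewrite ler_wpM2l ?sqr_ge0// ler_pXn2r// nnegrE ?frob_ge0//.
    by rewrite mulr_ge0// frob_ge0.
  rewrite exprMn mulrCA ler_wpM2l ?sqr_ge0//.
  by rewrite mulrC.
have VW : V <= m%:R * D * ((eps0 ^+ 2 + K ^+ 2 / M ^+ 2) * frob W ^+ 2).
  have -> : V = m%:R * D * (frob h ^+ 2 * frob h ^+ 2 +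
      K ^+ 2 / M ^+ 2 * (frob x ^+ 2 * frob h ^+ 2)) by rewrite /V; ring.
  apply: ler_wpM2l; first exact: mulr_ge0.
  rewrite mulrDl; apply: lerD => //.
  by apply: ler_wpM2l => //; rewrite divr_ge0 ?sqr_ge0.
apply: (@le_trans _ _ ((3 * frob q) ^+ 2)).
  rewrite ler_pXn2r// ?nnegrE ?frob_ge0 ?mulr_ge0 ?frob_ge0//.
  exact: frob_projT_le.
rewrite exprMn.
apply: (@le_trans _ _ (9 * (tau_z ^+ 2 * (m%:R * D *
    ((eps0 ^+ 2 + K ^+ 2 / M ^+ 2) * frob W ^+ 2)) * (m%:R * (1 + 2 * D))))).
  have -> : (3 : R) ^+ 2 = 9 by ring.
  rewrite ler_pM2l// (le_trans q_le)// ler_wpM2r//.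
    by apply: mulr_ge0.
  by rewrite ler_wpM2l ?sqr_ge0.
by rewrite le_eqVlt; apply/orP; left; apply/eqP; ring.
Qed.

End truncated_operator.

(** * Choice of the constants and conclusion *)

(** Keep only the exponential part of [2 * rho1] in the second member of the maximum. The bound is
    free of [eta], so [rho3_max] can be chosen before [eta]. *)
Lemma vartheta_up_ge (R : realType) (tau_z eta : R) : 0 < eta ->
  20 * tau_z ^+ 3 * expR (- (49 / 100) * tau_z ^+ 2) <= vartheta_up tau_z eta.
Proof.
move=> eta0; rewrite /vartheta_up le_max; apply/orP; right.
have v2 : 0 <= vartheta2 tau_z.
  apply: fine_ge0; apply: expectation_ge0 => t.
  by rewrite mulr_ge0// exprn_ge0.
rewrite /rho1; lra.
Qed.

Theorem theorem4p2 (R : realType) (tau_x tau_z tau_h : R)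
    (htau_x : 0 < tau_x) (htau_z : 0 < tau_z) (htau_h : 0 < tau_h) :
  exists rho3_max : R, 0 < rho3_max /\
  forall eta : R, 0 < eta ->
  exists C c : R, [/\ 0 < C, 0 < c &
  forall rho3 : R, 0 < rho3 -> rho3 <= rho3_max ->
  forall eps0 : R, 0 < eps0 -> eps0 <= eps0_bound tau_x tau_z tau_h rho3 ->
  forall (n m : nat) (x : 'cV[R]_n), x != 0 -> C * n%:R <= m%:R ->
  forall (d : measure_display) (T : measurableType d) (P : probability T R)
    (a : 'I_m -> {RV P >-> n.-tuple R}),
  (forall k, std_gaussian_vector (a k)) -> mutually_independent a ->
  prob_exceeds P (1 - expR (- c * m%:R))
    [set w | forall z : 'cV[R]_n,
      let W := z *m z^T - x *m x^T in
      frob W <= eps0 * frob (x *m x^T) ->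
      m%:R^-1 * frob (projT z (adjAz tau_x tau_z tau_h (sample a w) x z
                        (measAz tau_x tau_z tau_h (sample a w) x z
                          (W - projT z W))))
      <= Num.sqrt (rho4 tau_x tau_z tau_h eta rho3 * vartheta_up tau_z eta)
         * frob W]].
Proof.
have [D DE] : exists D : R, D = 4 * 128 ^+ 2 by eexists.
have D0 : 0 < D by rewrite DE mulr_gt0 ?exprn_gt0 ?ltr0n.
pose B := 9 * tau_z ^+ 2 * (1 + 2 * D) * D.
have B0 : 0 < B.
  apply: mulr_gt0 => //; apply: mulr_gt0.
    by apply: mulr_gt0; [rewrite ltr0n|exact: exprn_gt0].
  by apply: addr_gt0 => //; exact: mulr_gt0.
pose th := 20 * tau_z ^+ 3 * expR (- (49 / 100) * tau_z ^+ 2).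
have th0 : 0 < th by rewrite !mulr_gt0 ?exprn_gt0 ?expR_gt0.
(* The bound on [eps0] gives [eps0 <= rho3 / (30 * tau_z * tau_hz) <= rho3 / r], because
   [tau_z <= tau_hz]. *)
pose r := 30 * tau_z ^+ 2.
have r0 : 0 < r by rewrite mulr_gt0 ?exprn_gt0 ?ltr0n.
(* Exactly the threshold on [rho3] below which [B * (rho3 / r) ^+ 2 <= rho3 * th]. *)
exists (r ^+ 2 * th / B); split.
  by apply: divr_gt0 => //; apply: mulr_gt0 => //; exact: exprn_gt0.
move=> eta eta0.
pose K := tau_x * Num.sqrt (1 + 2 * D) + tau_z.
(* As [M ^+ 2 >= M >= B * K ^+ 2 / (eta * th)], the contribution of [K ^+ 2 / M ^+ 2] is absorbed by
   [eta]. *)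
pose M := 1 + B * K ^+ 2 / (eta * th).
have M1 : 1 <= M.
  rewrite lerDl; apply: divr_ge0; last by apply/ltW/mulr_gt0.
  by apply: mulr_ge0; [exact: ltW|exact: sqr_ge0].
have M0 : 0 < M by exact: lt_le_trans M1.
have BM : B * (K ^+ 2 / M ^+ 2) <= eta * th.
  have et0 : 0 < eta * th by exact: mulr_gt0.
  rewrite mulrA ler_pdivrMr ?exprn_gt0//.
  apply: (@le_trans _ _ (eta * th * M)).
    by rewrite /M mulrDr mulr1 [X in _ + X]mulrC divfK ?gt_eqF// lerDr ltW.
  by rewrite ler_pM2l// expr2 ler_peMr// ltW.
have [C [c [C0 c0 unif]]] := uniform_psi_sum M1.
rewrite -DE in unif.
exists C, c; split=> // rho3 rho30 rho3_le eps0 eps00 eps0_le n m x x0 Cnm d T P a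
  ga ia.
(* In dimension zero every vector is zero, contradicting [x0]. *)
have n0 : (0 < n)%N.
  case: n x x0 {Cnm a ga ia} => // x; apply: contra_neqT => _.
  by apply/matrixP => -[].
have m0 : (0 < m)%N.
  by rewrite -(ltr0n R) (lt_le_trans _ Cnm)// mulr_gt0 ?ltr0n.
have [E [mE Esub PE]] := unif n m n0 Cnm d T P a ga ia.
exists E; split=> // w /Esub/= aw z Weps.
pose W := z *m z^T - x *m x^T; rewrite -/W in Weps *.
have aD (v : 'cV[R]_n) : frob v <= 1 ->
    \sum_k psi M (dotv (sample a w k) v) <= m%:R * D.
  move=> v1; have := aw v.
  rewrite -frob_colE -[X in _ ^+ 2 <= X](expr1n _ 2) ler_pXn2r ?nnegrE ?frob_ge0//.
  move=> /(_ v1); congr (_ <= _); apply: eq_bigr => k _; congr (psi _ _).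
  by rewrite dotvE; apply: eq_bigr => i _; rewrite mxE.
have [e1 e2] : eps0 <= rho3 / r /\ eps0 < 1.
  move: eps0_le; rewrite /eps0_bound => eps0_le.
  have hz : tau_z <= tau_hz tau_x tau_z tau_h by rewrite lerDl sqrtr_ge0.
  set y := rho3 / _ in eps0_le.
  have h1 : Num.min (Num.sqrt (rho3 / (3 * (tau_z ^+ 4 + 5 * tau_z ^+ 3
      + 8 * tau_z ^+ 2 + 2 * tau_h ^+ 2)))) (Num.min (rho3 / (15 * tau_z *
      tau_hz tau_x tau_z tau_h)) (1 / 11)) <= Num.min (rho3 / (15 * tau_z *
      tau_hz tau_x tau_z tau_h)) (1 / 11) by rewrite ge_min lexx orbT.
  have h2 := le_trans eps0_le (ler_wpM2l (ltac:(lra) : 0 <= 1 / 2 :> R) h1).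
  split.
    apply: (le_trans h2).
    apply: (@le_trans _ _ (1 / 2 * (rho3 / (15 * tau_z * tau_z)))); last first.
      by rewrite le_eqVlt; apply/orP; left; apply/eqP; rewrite /r; field; rewrite gt_eqF.
    rewrite ler_wpM2l//; apply: (@le_trans _ _ (rho3 / (15 * tau_z *
      tau_hz tau_x tau_z tau_h))); first by rewrite ge_min lexx.
    rewrite ler_wpM2l ?(ltW rho30)// lef_pV2 ?posrE ?mulr_gt0//.
      by rewrite ler_wpM2l// mulr_ge0// ltW.
    exact: lt_le_trans hz.
  apply: (le_lt_trans h2).
  apply: (@le_lt_trans _ _ (1 / 2 * (1 / 11))); last by lra.
  by rewrite ler_wpM2l// ge_min lexx orbT.
have Beps : B * eps0 ^+ 2 <= rho3 * th.
  apply: (@le_trans _ _ (B * (rho3 / r) ^+ 2)).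
    rewrite ler_wpM2l ?(ltW B0)// ler_pXn2r// nnegrE ?(ltW eps00)//.
    by rewrite divr_ge0 ?(ltW rho30) ?(ltW r0).
  have -> : B * (rho3 / r) ^+ 2 = rho3 * (rho3 * (B / r ^+ 2)).
    by field; rewrite gt_eqF.
  rewrite ler_pM2l// -ler_pdivlMr ?divr_gt0 ?exprn_gt0//.
  rewrite (le_trans rho3_le)// le_eqVlt; apply/orP; left; apply/eqP.
  by field; rewrite !gt_eqF.
have := truncated_operator_bound tau_h htau_x htau_z m0 M1 (ltW D0) aD x0 (ltW eps00)
  e2 Weps.
rewrite -/W -/K -/B; set G := projT z _ => HG.
have rho4_ge : rho3 + eta <= rho4 tau_x tau_z tau_h eta rho3.
  rewrite /rho4 addrAC lerDl; apply: mulr_ge0; last exact: expR_ge0.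
  by apply: mulr_ge0; [apply: mulr_ge0 => //; exact: ltW|exact: sqr_ge0].
have re0 : 0 <= rho3 + eta by rewrite addr_ge0// ltW.
have prod_ge : (rho3 + eta) * th <=
    rho4 tau_x tau_z tau_h eta rho3 * vartheta_up tau_z eta.
  apply: ler_pM => //; first exact: ltW.
  exact: vartheta_up_ge.
(* The two terms of [truncated_operator_bound] are matched separately: [eps0 ^+ 2] with [rho3] by
   [Beps], and [K ^+ 2 / M ^+ 2] with [eta] by [BM]. *)
have key : frob G ^+ 2 <= (rho3 + eta) * th * (m%:R ^+ 2 * frob W ^+ 2).
  apply: (le_trans HG); rewrite -(mulrA _ (m%:R ^+ 2)) ler_wpM2r//.
    by rewrite mulr_ge0 ?sqr_ge0.
  by rewrite mulrDr mulrDl lerD.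
rewrite ler_pdivrMl ?ltr0n//.
rewrite -(@ler_pXn2r _ 2)// ?nnegrE ?mulr_ge0 ?frob_ge0 ?sqrtr_ge0//.
have p0 : 0 <= rho4 tau_x tau_z tau_h eta rho3 * vartheta_up tau_z eta.
  by apply: le_trans prod_ge; rewrite mulr_ge0// ltW.
rewrite 2!exprMn (sqr_sqrtr p0).
apply: (le_trans key); rewrite mulrCA ler_wpM2r// mulr_ge0 ?sqr_ge0//.
Qed.
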